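(* Let $\gamma:[0,1]\to\mathbb{R}^2$ be a continuous, piecewise $W^{2,1}$, regular closed curve (self-intersections are allowed), possibly with angles $\theta_i$, $i\in\{1,\ldots,N\}$, at the vertices $\gamma(x_i)$. Then $$\int_\gamma |k|\,\mathrm{d}s\;\geq\; 2\pi-\sum_{i=1}^N\theta_i .$$
   Context: There is a partition $0=x_0<x_1<\dots<x_N=1$ of $[0,1]$ such that $\gamma$ is of class $W^{2,1}$ and regular (nonvanishing derivative, including one-sided derivatives at the endpoints) on each interval $[x_{i-1},x_i]$, $i\in\{1,\dots,N\}$, and $\gamma(0)=\gamma(1)$. The points $\gamma(x_i)$ are called vertices. The angle $\theta_i\in[0,\pi]$ at the vertex $\gamma(x_i)$, $i\in\{1,\dots,N\}$, is defined by $$\cos(\theta_i)=\frac{\langle\gamma'(x_i^-),\gamma'(x_i^+)\rangle}{|\gamma'(x_i^-)|\,|\gamma'(x_i^+)|},$$ with the convention $x_N^+:=x_0^+$. The scalar curvature $k$ is defined a.e. by $\partial_s^2\gamma=k\nu$, where $\partial_s=\partial_x/|\partial_x\gamma|$, $\nu$ is the counterclockwise rotation by $\pi/2$ of the unit tangent $\tau=\partial_s\gamma$, and $\mathrm{d}s=|\partial_x\gamma|\,\mathrm{d}x$. *)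

(* Defs.v *)
From HB Require Import structures.
From mathcomp Require Import all_boot all_order all_algebra.
From mathcomp Require Import all_classical all_reals all_analysis.

Set Implicit Arguments.
Unset Strict Implicit.
Unset Printing Implicit Defensive.

Import Order.TTheory GRing.Theory Num.Theory.
Import numFieldNormedType.Exports.

Local Open Scope classical_set_scope.
Local Open Scope ring_scope.

Section Sobolev.
Variable R : realType.
Implicit Types (a b : R) (u g phi : R -> R).

Definition test_function a b phi : Prop :=
  [/\ forall t, derivable phi t 1, continuous phi^`()%classic,
      compact (closure [set t | phi t != 0])
    & closure [set t | phi t != 0] `<=` `]a, b[%classic].

Definition L1 a b u : Prop :=
  (@lebesgue_measure R).-integrable `]a, b[%classic (EFin \o u).

Definition weak_derivative a b u g : Prop :=
  forall phi, test_function a b phi ->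
    \int[@lebesgue_measure R]_(t in `]a, b[%classic) (u t * phi^`()%classic t) =
    - \int[@lebesgue_measure R]_(t in `]a, b[%classic) (g t * phi t).

(* The Sobolev space W^{m,1}(a, b), with C^1_c test functions as in Brezis
   (Functional Analysis, Sobolev Spaces and PDEs, Chapter 8). *)
Fixpoint sobolev1 (m : nat) a b u : Prop :=
  L1 a b u /\
  match m with
  | 0%N => True
  | m'.+1 => exists g, weak_derivative a b u g /\ sobolev1 m' a b g
  end.

End Sobolev.

Section PlaneCurves.
Variable R : realType.
Implicit Types (u v : 'rV[R]_2) (c f : R -> 'rV[R]_2).

Definition dot u v : R := \sum_j u 0 j * v 0 j.

(* The library norm on 'rV[R]_2 is the maximum norm, hence this definition. *)
Definition enorm u : R := Num.sqrt (dot u u).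

Definition rot90 u : 'rV[R]_2 :=
  \row_j (if j == 0 then - u 0 1 else u 0 0).

Definition lderiv c (t : R) : 'rV[R]_2 :=
  lim (h^-1 *: (c (t + h) - c t) @[h --> 0^'-]).

Definition rderiv c (t : R) : 'rV[R]_2 :=
  lim (h^-1 *: (c (t + h) - c t) @[h --> 0^'+]).

Definition W21 (a b : R) c : Prop :=
  forall j, sobolev1 2 a b (fun t => c t 0 j).

Definition regular (a b : R) c : Prop :=
  [/\ forall t, a < t < b -> c^`()%classic t != 0, rderiv c a != 0 & lderiv c b != 0].

(* [arc_deriv c f] is the arclength derivative of [f] along the curve [c]. *)
Definition arc_deriv c f (t : R) : 'rV[R]_2 := (enorm (c^`()%classic t))^-1 *: f^`()%classic t.

Definition tangent c : R -> 'rV[R]_2 := arc_deriv c c.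

Definition normal c (t : R) : 'rV[R]_2 := rot90 (tangent c t).

Definition is_curvature c (k : R -> R) : Prop :=
  {ae @lebesgue_measure R, forall t, t \in `[0, 1] ->
    arc_deriv c (arc_deriv c c) t = k t *: normal c t}.

(* Vertices are numbered from 1 to N; [i %% N] sends N to 0 and fixes the other
   ones, which is the convention that x_N^+ stands for x_0^+. *)
Definition is_vertex_angle c (N : nat) (x : nat -> R) (i : nat) (theta : R)
    : Prop :=
  0 <= theta <= pi /\
  cos theta = dot (lderiv c (x i)) (rderiv c (x (i %% N)%N))
              / (enorm (lderiv c (x i)) * enorm (rderiv c (x (i %% N)%N))).

End PlaneCurves.

(* Main.v *)
Require Import Defs.
From HB Require Import structures.
From mathcomp Require Import all_boot all_order all_algebra.
From mathcomp Require Import all_classical all_reals all_analysis.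
From mathcomp Require Import measurable_realfun ring lra.

Import Order.TTheory GRing.Theory Num.Theory.
Import numFieldNormedType.Exports.

Local Open Scope classical_set_scope.
Local Open Scope ring_scope.

(** On each arc the derivative of the curve is absolutely continuous, so its
    direction is [expi phi] for an angle function [phi] which is a primitive
    of [k |gamma'|].  At the [i]-th vertex the direction turns by [theta i] or
    [- theta i].  Adding these turns gives one angle function along the whole
    curve, of total variation [L], the integral of [|k|] plus the sum of the
    angles; after one period it changes by a multiple of [2 pi].  If [L < 2 pi]
    this multiple is zero, so any two values of the angle are at distance at
    most [L / 2], and all of them are within [L / 4 < pi / 2] of a single angle [u].
    Then [gamma] has a positive velocity in the direction [expi u], and it
    cannot be closed. *)

(** * Absolutely continuous functions *)

Section primitives.
Context {R : realType}.
Notation mu := (@lebesgue_measure R).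
Implicit Types (a b s t r : R) (F G f g : R -> R).

(** The second derivative of the curve is merely integrable, so its angle cannot be handled
    pointwise: a derivative that vanishes almost everywhere does not make a function constant.
    Absolute continuity is therefore encoded as the integral identity [primitive], and the product
    and chain rules are proved for that identity itself. The weak formulation determines derivatives
    only almost everywhere, whereas regularity and the vertex angles involve one-sided derivatives
    of the curve at single points; a continuous representative of the weak derivative has to link
    the two. The bound [L / 2] comes from the two ways round: two values of the angle are joined by
    two complementary portions of the closed curve, whose variations sum to [L], so one of them has
    variation at most [L / 2]. This needs the angle to return to its initial value exactly, and not
    only modulo [2 pi]. The sign of the turn at a vertex is not determined by the cosine, but only
    its absolute value enters the variation. *)

Definition primitive a b F f : Prop :=
  mu.-integrable `[a, b] (EFin \o f) /\
  forall s t, a <= s -> s <= t -> t <= b ->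
    F t - F s = \int[mu]_(r in `[s, t]) f r.

Lemma integrable_subitv a b s t f : mu.-integrable `[a, b] (EFin \o f) ->
  a <= s -> t <= b -> mu.-integrable `[s, t] (EFin \o f).
Proof.
move=> fi as_ tb; apply: integrableS fi => //.
by apply: subset_itv; rewrite bnd_simp.
Qed.

Lemma Rintegral_itv_cat a b s t f : mu.-integrable `[a, b] (EFin \o f) ->
  a <= s -> s <= t -> t <= b ->
  \int[mu]_(r in `[a, t]) f r =
  \int[mu]_(r in `[a, s]) f r + \int[mu]_(r in `[s, t]) f r.
Proof.
move=> fi as_ st tb; apply/eqP; rewrite addrC -subr_eq; apply/eqP.
rewrite Rintegral_itvB ?bnd_simp//; last exact: integrable_subitv fi _ tb.
rewrite Rintegral_itv_obnd_cbnd//.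
apply: integrableS (integrable_subitv _ _ _ _ _ fi as_ tb) => //.
exact: subset_itv_oc_cc.
Qed.

Lemma integral_primitive a b f : mu.-integrable `[a, b] (EFin \o f) ->
  primitive a b (fun t => \int[mu]_(r in `[a, t]) f r) f.
Proof.
move=> fi; split => // s t as_ st tb.
by rewrite (Rintegral_itv_cat _ _ _ _ _ fi as_ st tb) addrAC subrr add0r.
Qed.

Lemma primitiveE a b F f t : primitive a b F f -> a <= t -> t <= b ->
  F t = F a + \int[mu]_(r in `[a, t]) f r.
Proof. by move=> [fi Ff] at_ tb; rewrite -Ff// addrC subrK. Qed.

Lemma primitive_continuous a b F f : a <= b -> primitive a b F f ->
  {within `[a, b], continuous F}.
Proof.
move=> ab Ff; have fi := Ff.1.
apply: (@subspace_eq_continuous _ _ _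
    (fun t => F a + parameterized_integral mu a t f)).
  move=> t; rewrite inE/= in_itv/= => /andP[at_ tb].
  exact: esym (primitiveE _ _ _ _ _ Ff at_ tb).
move=> t; apply: cvgD; first exact: cvg_cst.
exact: (parameterized_integral_continuous ab fi).
Qed.

Lemma within_itv_ballP a b F r : {within `[a, b], continuous F} ->
  a <= r -> r <= b -> forall e : R, 0 < e ->
  exists2 d : R, 0 < d & forall t, a <= t -> t <= b -> `|t - r| < d ->
    `|F t - F r| < e.
Proof.
move=> /subspace_continuousP cF ar rb e e0.
have rab : `[a, b]%classic r by rewrite /= in_itv/= ar rb.
have /cvgrPdist_lt/(_ e e0) := cF r rab.
rewrite near_withinE => -[d /= d0 H]; exists d => // t at_ tb td.
rewrite distrC; apply: H => /=; last by rewrite in_itv/= at_ tb.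
by rewrite distrC.
Qed.

(* Cousin's argument: an increment bound holding on every short interval
   around each point adds up to a bound on the whole interval. *)
Lemma increment_le a b F G : a <= b ->
  (forall r, a <= r -> r <= b -> exists2 d : R, 0 < d &
     forall s t, a <= s -> s <= r -> r <= t -> t <= b -> t - s < d ->
       `|F t - F s| <= G t - G s) ->
  `|F b - F a| <= G b - G a.
Proof.
move=> ab H.
pose S := [set t | a <= t <= b /\ `|F t - F a| <= G t - G a].
have Sa : S a by split; rewrite ?lexx ?ab// !subrr normr0.
have Sb : ubound S b by move=> t [/andP[]].
have hS : has_sup S by split; [exists a | exists b].
have [c cE] : exists c : R, c = sup S by exists (sup S).
have ubc x : S x -> x <= c by rewrite cE; apply: ub_le_sup; exists b.
have ac : a <= c by exact: ubc.
have cb : c <= b by rewrite cE; apply: ge_sup => //; exists a.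
have [d d0 Hd] := H _ ac cb.
have [s [/andP[as_ sb] Ss] ds] := sup_adherent (divr_gt0 d0 (ltr0n _ 2)) hS.
rewrite -cE in ds.
have sc : s <= c by apply: ubc; split; rewrite ?as_.
(* As [s] is within [d / 2] of [c], the interval from [s] to [t] is shorter than [d]. Unless [t] is
   [b], it lies beyond the supremum [c], which is absurd. *)
pose t := Num.min b (c + d / 4).
have cd : c <= c + d / 4 by lra.
have ct : c <= t by rewrite /t le_min cb cd.
have tb : t <= b by rewrite /t ge_min lexx.
have td : t <= c + d / 4 by rewrite /t ge_min lexx orbT.
have St : S t.
  split; first by rewrite tb (le_trans ac ct).
  have -> : F t - F a = (F t - F s) + (F s - F a) by lra.
  have -> : G t - G a = (G t - G s) + (G s - G a) by lra.
  apply: (le_trans (ler_normD _ _)); apply: lerD => //.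
  by apply: Hd => //; lra.
have tc : t <= c by exact: ubc.
have [bcd|cdb] := leP b (c + d / 4).
  by move: St.2; rewrite /t min_l.
have te : t = c + d / 4 by rewrite /t min_r// ltW.
by exfalso; lra.
Qed.

Lemma subrACA (V : zmodType) (x y z w : V) :
  (x - y) - (z - w) = (x - z) - (y - w).
Proof. by rewrite !opprB [w - z]addrC [w - y]addrC addrACA. Qed.

(** The error is measured by the integral of [g] instead of [t - s], since the densities may be
    unbounded. Local errors add up by [increment_le], applied to [F] minus the integral of [f]; the
    total is [e] times a fixed number, with [e] arbitrary. *)
Lemma primitive_local a b F f g : mu.-integrable `[a, b] (EFin \o f) ->
  mu.-integrable `[a, b] (EFin \o g) -> (forall r, 0 <= g r) ->
  (forall (e : R) r, 0 < e -> a <= r -> r <= b -> exists2 d : R, 0 < d &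
     forall s t, a <= s -> s <= r -> r <= t -> t <= b -> t - s < d ->
       `|F t - F s - \int[mu]_(x in `[s, t]) f x| <=
       e * \int[mu]_(x in `[s, t]) g x) ->
  primitive a b F f.
Proof.
move=> fi gi g0 H; split => // s t as_ st tb.
have [_ P1] := integral_primitive _ _ _ fi.
have [_ P2] := integral_primitive _ _ _ gi.
pose D := fun x => F x - \int[mu]_(r in `[a, x]) f r.
have key (e : R) : 0 < e ->
    `|F t - F s - \int[mu]_(r in `[s, t]) f r| <=
    e * \int[mu]_(r in `[s, t]) g r.
  move=> e0.
  pose E := fun x => e * \int[mu]_(r in `[a, x]) g r.
  have DE s' t' : a <= s' -> s' <= t' -> t' <= b ->
      D t' - D s' = F t' - F s' - \int[mu]_(r in `[s', t']) f r.
    by move=> *; rewrite -P1//; exact: subrACA.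
  have EE s' t' : a <= s' -> s' <= t' -> t' <= b ->
      E t' - E s' = e * \int[mu]_(r in `[s', t']) g r.
    by move=> *; rewrite -P2// mulrBr.
  rewrite -DE// -EE//; apply: increment_le => // r sr rt.
  have [d d0 Hd] := H e r e0 (le_trans as_ sr) (le_trans rt tb).
  exists d => // s' t' ss' s'r rt' t't td.
  have as' : a <= s' by rewrite (le_trans as_).
  have t'b : t' <= b by rewrite (le_trans t't).
  have st' : s' <= t' by rewrite (le_trans s'r).
  by rewrite DE// EE//; exact: Hd.
apply/eqP; rewrite -subr_eq0 -normr_le0; apply/ler_addgt0Pl => e e0.
rewrite addr0; set I := \int[mu]_(r in `[s, t]) g r in key.
have I0 : 0 <= I by apply: Rintegral_ge0.
(* The summand 1 keeps the denominator positive when [I] is zero. *)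
apply: (le_trans (key (e / (1 + I)) _)); first by rewrite divr_gt0//; lra.
rewrite mulrAC ler_pdivrMr; last lra.
by rewrite ler_pM2l//; lra.
Qed.

Lemma integrable_continuousM a b f G : {within `[a, b], continuous G} ->
  mu.-integrable `[a, b] (EFin \o f) ->
  mu.-integrable `[a, b] (EFin \o (fun x => f x * G x)).
Proof.
move=> cG fi.
have cpt : compact `[a, b]%classic by exact: segment_compact.
have mG : measurable_fun `[a, b] G.
  have /integrableP[] := continuous_compact_integrable cpt cG.
  by move/measurable_EFinP.
have bG : [bounded G x | x in `[a, b]].
  have /compact_bounded[M [_ HM]] := continuous_compact cG cpt.
  by exists M; split; rewrite ?num_real // => ? ? ? ?; exact: HM.
exact: (integrableMl _ fi mG bG).
Qed.

Lemma norm_Rintegral_le a b f g (e : R) : mu.-integrable `[a, b] (EFin \o f) ->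
  mu.-integrable `[a, b] (EFin \o g) ->
  (forall r, a <= r -> r <= b -> `|f r| <= e * g r) ->
  `|\int[mu]_(r in `[a, b]) f r| <= e * \int[mu]_(r in `[a, b]) g r.
Proof.
move=> fi gi H; apply: (le_trans (le_normr_Rintegral _ _)) => //.
rewrite -RintegralZl//; apply: le_Rintegral => //.
- exact: integrable_norm.
- by apply: (integrableZl _ _ gi).
- by move=> r; rewrite /= in_itv/= => /andP[]; exact: H.
Qed.

End primitives.

(** * Product and chain rules for absolutely continuous functions *)

Section primitive_calculus.
Context {R : realType}.
Notation mu := (@lebesgue_measure R).
Implicit Types (a b s t r : R) (F G f g p dp : R -> R).

Lemma primitiveD a b F G f g : primitive a b F f -> primitive a b G g ->
  primitive a b (fun t => F t + G t) (fun t => f t + g t).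
Proof.
move=> [fi Ff] [gi Gg]; split.
  exact: (integrableD _ fi gi).
move=> s t as_ st tb; rewrite RintegralD//; last 2 first.
- exact: integrable_subitv fi as_ tb.
- exact: integrable_subitv gi as_ tb.
by rewrite -Ff// -Gg// opprD addrACA.
Qed.

Lemma primitiveN a b F f : primitive a b F f ->
  primitive a b (fun t => - F t) (fun t => - f t).
Proof.
move=> [fi Ff]; split; first exact: (integrableN fi).
move=> s t as_ st tb.
under eq_Rintegral do rewrite -mulN1r.
rewrite RintegralZl//; last exact: integrable_subitv fi as_ tb.
by rewrite -Ff// mulN1r !opprB addrC opprK addrC.
Qed.

Lemma half_dist_le r (e x y : R) :
  `|x - r| < e / 2 -> `|y - r| < e / 2 -> `|x - y| <= e.
Proof.
move=> xr yr; have -> : x - y = (x - r) - (y - r) by ring.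
by apply: (le_trans (ler_normB _ _)); lra.
Qed.

Lemma dist_lt_itv s t r (x d : R) :
  s <= r -> r <= t -> t - s < d -> s <= x -> x <= t -> `|x - r| < d.
Proof. by move=> *; rewrite ltr_norml; apply/andP; split; lra. Qed.

(** By the discrete Leibniz rule, the increment of the product is the integral of
    [f * G t + g * F s] with the factors [G t] and [F s] frozen. On a short interval continuity
    replaces them by [G x] and [F x], at a cost of [e] times the integral of [|f| + |g|]. *)
Lemma primitiveM a b F G f g : a <= b ->
  primitive a b F f -> primitive a b G g ->
  primitive a b (fun t => F t * G t) (fun t => f t * G t + g t * F t).
Proof.
move=> ab Ff Gg.
have cF := primitive_continuous _ _ _ _ ab Ff.
have cG := primitive_continuous _ _ _ _ ab Gg.
have [[fi HF] [gi HG]] := (Ff, Gg).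
have fGi := integrable_continuousM _ _ _ _ cG fi.
have gFi := integrable_continuousM _ _ _ _ cF gi.
have nfi := integrable_norm fi.
have ngi := integrable_norm gi.
have mi : mu.-integrable `[a, b] (EFin \o (fun x => `|f x| + `|g x|)).
  exact: (integrableD _ nfi ngi).
apply: (primitive_local _ _ _ _ (fun x => `|f x| + `|g x|)) => //.
  exact: (integrableD _ fGi gFi).
move=> e r e0 ar rb.
have e20 : 0 < e / 2 by rewrite divr_gt0.
have [d1 d10 H1] := within_itv_ballP _ _ _ _ cF ar rb _ e20.
have [d2 d20 H2] := within_itv_ballP _ _ _ _ cG ar rb _ e20.
exists (Num.min d1 d2); first by rewrite lt_min d10.
move=> s t as_ sr rt tb; rewrite lt_min => /andP[td1 td2].
have st : s <= t by exact: le_trans rt.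
have I h : mu.-integrable `[a, b] (EFin \o h) ->
    mu.-integrable `[s, t] (EFin \o h).
  by move=> hi; exact: integrable_subitv hi as_ tb.
pose h1 x := f x * G t; pose h2 x := g x * F s.
pose h x := h1 x + h2 x; pose k x := f x * G x + g x * F x.
have h1i : mu.-integrable `[s, t] (EFin \o h1).
  by apply: (integrableZr _ _ (I _ fi)).
have h2i : mu.-integrable `[s, t] (EFin \o h2).
  by apply: (integrableZr _ _ (I _ gi)).
have hi : mu.-integrable `[s, t] (EFin \o h) by exact: (integrableD _ h1i h2i).
have ki : mu.-integrable `[s, t] (EFin \o k).
  by apply: I; exact: (integrableD _ fGi gFi).
have -> : F t * G t - F s * G s - \int[mu]_(x in `[s, t]) (f x * G x + g x * F x)
  = \int[mu]_(x in `[s, t]) (h x - k x).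
  rewrite RintegralB//; congr (_ - _).
  rewrite RintegralD// /h1 /h2 RintegralZr//; last exact: I.
  rewrite RintegralZr//; last exact: I.
  by rewrite -HF// -HG//; ring.
apply: norm_Rintegral_le; [exact: (integrableB _ hi ki)|exact: I|].
rewrite /h /h1 /h2 /k.
move=> x sx xt.
have -> : f x * G t + g x * F s - (f x * G x + g x * F x) =
  f x * (G t - G x) + g x * (F s - F x) by ring.
apply: (le_trans (ler_normD _ _)); rewrite [leRHS]mulrDr !normrM.
have as' : a <= x by exact: le_trans sx.
have xb' : x <= b by exact: le_trans tb.
have at' : a <= t by exact: le_trans as' xt.
have sb' : s <= b by exact: le_trans tb.
apply: lerD; rewrite mulrC; apply: ler_wpM2r => //.
- by apply: (@half_dist_le (G r)); apply: H2 => //; exact: (@dist_lt_itv s t).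
- by apply: (@half_dist_le (F r)); apply: H1 => //; exact: (@dist_lt_itv s t).
Qed.

(** [F] need not be differentiable, so the mean value theorem is applied to [p] between the values
    [F s] and [F t]: it gives a frozen factor [dp y], with [y] close to [F r]. *)
Lemma primitive_comp a b F f p dp : a <= b -> primitive a b F f ->
  (forall x : R, is_derive x 1 p (dp x)) -> continuous dp ->
  primitive a b (fun t => p (F t)) (fun t => f t * dp (F t)).
Proof.
move=> ab Ff pdp cdp.
have cF := primitive_continuous _ _ _ _ ab Ff.
have [fi HF] := Ff.
have cdF : {within `[a, b], continuous (dp \o F)}.
  by move=> x; apply: (cvg_comp _ _ (cF x)); exact: cdp.
have fdi := integrable_continuousM _ _ _ _ cdF fi.
have nfi := integrable_norm fi.
apply: (primitive_local _ _ _ _ (fun x => `|f x|)) => //.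
move=> e r e0 ar rb.
have e20 : 0 < e / 2 by rewrite divr_gt0.
have /cvgrPdist_lt/(_ _ e20)[d0 /= d00 Hd0] := cdp (F r).
have [d d0' H1] := within_itv_ballP _ _ _ _ cF ar rb _ d00.
exists d => // s t as_ sr rt tb td.
have st : s <= t by exact: le_trans rt.
have I h : mu.-integrable `[a, b] (EFin \o h) ->
    mu.-integrable `[s, t] (EFin \o h).
  by move=> hi; exact: integrable_subitv hi as_ tb.
have near x : s <= x -> x <= t -> `|F x - F r| < d0.
  move=> sx xt; apply: H1; rewrite ?(le_trans as_)// ?(le_trans xt)//.
  exact: (@dist_lt_itv s t).
have nFs := near _ (lexx s) st; have nFt := near _ st (lexx t).
have [y ny yE] : exists2 y, `|y - F r| < d0 & p (F t) - p (F s) = dp y * (F t - F s).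
  have MV u v : u <= v -> `|u - F r| < d0 -> `|v - F r| < d0 ->
      exists2 y, `|y - F r| < d0 & p v - p u = dp y * (v - u).
    move=> uv; rewrite !ltr_norml => /andP[u1 u2] /andP[v1 v2].
    have [|y yin ->] := @MVT_segment R p dp u v uv (fun x _ => pdp x).
      apply: continuous_subspaceT => x.
      by apply: differentiable_continuous; apply/derivable1_diffP; apply: ex_derive.
    exists y => //; move: yin; rewrite in_itv/= => /andP[y1 y2].
    rewrite ltr_norml (lt_le_trans u1) ?lerB//.
    by rewrite (le_lt_trans _ v2)// lerB.
  have [FsFt|/ltW FtFs] := leP (F s) (F t); first exact: MV.
  have [y ny yE] := MV _ _ FtFs nFt nFs; exists y => //.
  by rewrite -(opprB (p (F s))) yE -mulrN opprB.
pose h x := dp y * f x; pose k x := f x * dp (F x).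
have hi : mu.-integrable `[s, t] (EFin \o h).
  by apply: (integrableZl _ _ (I _ fi)).
have ki : mu.-integrable `[s, t] (EFin \o k) by exact: I.
rewrite yE HF//.
have -> : dp y * \int[mu]_(r in `[s, t]) f r - \int[mu]_(x in `[s, t]) (f x * dp (F x))
  = \int[mu]_(x in `[s, t]) (h x - k x).
  by rewrite RintegralB// /h RintegralZl//; exact: I.
apply: norm_Rintegral_le; [exact: (integrableB _ hi ki)|exact: I|].
rewrite /h /k.
move=> x sx xt.
have -> : dp y * f x - f x * dp (F x) = (dp y - dp (F x)) * f x by ring.
rewrite normrM ler_wpM2r//.
have D z : `|z - F r| < d0 -> `|dp z - dp (F r)| < e / 2.
  by move=> zr; rewrite distrC; apply: Hd0; rewrite /ball_/= distrC.
exact: half_dist_le (D _ ny) (D _ (near _ sx xt)).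
Qed.

End primitive_calculus.

(** * The polar angle of a nonvanishing absolutely continuous plane vector *)

Section polar_lift.
Context {R : realType}.
Notation mu := (@lebesgue_measure R).
Implicit Types (a b t : R) (F f G g v w h : R -> R).

Lemma primitive_addl a b F f (c : R) :
  primitive a b F f -> primitive a b (fun t => c + F t) f.
Proof.
move=> [fi Ff]; split => // s t as_ st tb.
by rewrite opprD addrACA subrr add0r Ff.
Qed.

Lemma primitive_density0 a b F f t : primitive a b F f ->
  (forall x, a <= x -> x <= b -> f x = 0) -> a <= t -> t <= b -> F t = F a.
Proof.
move=> Ff f0 at_ tb; rewrite (primitiveE _ _ _ _ _ Ff at_ tb).
rewrite (@eq_Rintegral _ _ _ _ _ (fun=> 0)).
  by rewrite Rintegral_cst// mul0r addr0.
by move=> x; rewrite inE/= in_itv/= => /andP[ax xt]; rewrite f0// (le_trans xt).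
Qed.

Lemma unit_polar (x y : R) : x ^+ 2 + y ^+ 2 = 1 ->
  exists u : R, x = cos u /\ y = sin u.
Proof.
move=> xy1; have x1 : -1 <= x <= 1 by apply/andP; split; nra.
have sx : sin (acos x) = `|y|.
  rewrite sin_acos//; have -> : 1 - x ^+ 2 = y ^+ 2 by lra.
  by rewrite sqrtr_sqr.
have cx : cos (acos x) = x by rewrite acosK// in_itv/=.
have [y0|y0] := leP 0 y.
  by exists (acos x); rewrite cx sx ger0_norm.
by exists (- acos x); rewrite cosN sinN cx sx ltr0_norm// opprK.
Qed.

Lemma polar (x y : R) : 0 < x ^+ 2 + y ^+ 2 ->
  exists r u : R, [/\ 0 < r, x = r * cos u & y = r * sin u].
Proof.
move=> xy0; pose r := Num.sqrt (x ^+ 2 + y ^+ 2).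
have r0 : 0 < r by rewrite sqrtr_gt0.
have r2 : r ^+ 2 = x ^+ 2 + y ^+ 2 by rewrite sqr_sqrtr// ltW.
have [|u [xE yE]] := @unit_polar (x / r) (y / r).
  by rewrite !expr_div_n -mulrDl -r2 divff// sqrf_eq0 gt_eqF.
exists r, u; split => //.
  by rewrite -xE mulrC divfK// gt_eqF.
by rewrite -yE mulrC divfK// gt_eqF.
Qed.

Lemma within_continuous_div a b v w : {within `[a, b], continuous v} ->
  {within `[a, b], continuous w} ->
  (forall t, a <= t -> t <= b -> w t != 0) ->
  {within `[a, b], continuous (fun t => v t / w t)}.
Proof.
move=> /subspace_continuousP cv /subspace_continuousP cw w0.
apply/subspace_continuousP => t tab.
apply: cvgM; first exact: cv.
apply: cvgV; last exact: cw.
by move: tab; rewrite /= in_itv/= => /andP[]; exact: w0.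
Qed.

(* With [phi' = (v1 h2 - v2 h1) / |v|^2] and [rho' = (v1 h1 + v2 h2) / |v|^2],
   the vector [exp (- rho)] times [v] rotated by [- phi] has derivative zero. *)
Lemma polar_lift a b v1 v2 h1 h2 : a <= b ->
  primitive a b v1 h1 -> primitive a b v2 h2 ->
  (forall t, a <= t -> t <= b -> 0 < v1 t ^+ 2 + v2 t ^+ 2) ->
  exists phi kappa Q, primitive a b phi kappa /\
    forall t, a <= t -> t <= b ->
      [/\ 0 < Q t, v1 t = Q t * cos (phi t) & v2 t = Q t * sin (phi t)].
Proof.
move=> ab P1 P2 n0.
have c1 := primitive_continuous _ _ _ _ ab P1.
have c2 := primitive_continuous _ _ _ _ ab P2.
pose n t := v1 t ^+ 2 + v2 t ^+ 2.
have cn : {within `[a, b], continuous n}.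
  by move=> t; apply: cvgD; apply: cvgM; [exact: c1|exact: c1|exact: c2|exact: c2].
have nn0 t : a <= t -> t <= b -> n t != 0 by move=> at_ tb; rewrite gt_eqF// n0.
pose w1 t := v1 t / n t; pose w2 t := v2 t / n t.
have cw1 : {within `[a, b], continuous w1} by exact: within_continuous_div.
have cw2 : {within `[a, b], continuous w2} by exact: within_continuous_div.
pose kappa t := h2 t * w1 t + - (h1 t * w2 t).
pose alpha t := h1 t * w1 t + h2 t * w2 t.
have int h w : {within `[a, b], continuous w} ->
    mu.-integrable `[a, b] (EFin \o h) ->
    mu.-integrable `[a, b] (EFin \o (fun t => h t * w t)).
  exact: integrable_continuousM.
have ik : mu.-integrable `[a, b] (EFin \o kappa).
  exact: (integrableB _ (int _ _ cw1 P2.1) (int _ _ cw2 P1.1)).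
have ia : mu.-integrable `[a, b] (EFin \o alpha).
  exact: (integrableD _ (int _ _ cw1 P1.1) (int _ _ cw2 P2.1)).
have [r0 [u [r00 v1a v2a]]] := polar _ _ (n0 a (lexx a) ab).
pose phi t := u + \int[mu]_(x in `[a, t]) kappa x.
pose rho t := \int[mu]_(x in `[a, t]) alpha x.
have Pphi : primitive a b phi kappa.
  exact/primitive_addl/integral_primitive.
have Prho : primitive a b rho alpha by exact: integral_primitive.
have phia : phi a = u by rewrite /phi set_itv1 Rintegral_set1 addr0.
have rhoa : rho a = 0 by rewrite /rho set_itv1 Rintegral_set1.
have cNs : continuous (fun x : R => - sin x).
  by move=> x; apply: cvgN; exact: continuous_sin.
have PC := primitive_comp _ _ _ _ _ _ ab Pphi
  (fun x => @is_derive_cos R x) cNs.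
have PS := primitive_comp _ _ _ _ _ _ ab Pphi
  (fun x => @is_derive_sin R x) (@continuous_cos R).
have PE := primitive_comp _ _ _ _ _ _ ab (primitiveN _ _ _ _ Prho)
  (fun x => @is_derive_expR R x) (@continuous_expR R).
have PQ := primitiveM _ _ _ _ _ _ ab PE (primitiveD _ _ _ _ _ _
  (primitiveM _ _ _ _ _ _ ab P1 PC) (primitiveM _ _ _ _ _ _ ab P2 PS)).
have PP := primitiveM _ _ _ _ _ _ ab PE (primitiveD _ _ _ _ _ _
  (primitiveM _ _ _ _ _ _ ab P2 PC)
  (primitiveN _ _ _ _ (primitiveM _ _ _ _ _ _ ab P1 PS))).
(* The components of [v] along and across the direction [phi]. Multiplied by [expR (- rho t)] both
   are constant, so the first stays positive and the second stays zero, as they are at [a]. *)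
pose Q t := v1 t * cos (phi t) + v2 t * sin (phi t).
pose P t := v2 t * cos (phi t) - v1 t * sin (phi t).
have EQ t : a <= t -> t <= b -> expR (- rho t) * Q t = r0.
  move=> at_ tb.
  have /= -> := primitive_density0 _ _ _ _ _ PQ _ at_ tb.
    rewrite phia rhoa oppr0 expR0 v1a v2a.
    by have := cos2Dsin2 u; nra.
  move=> x ax xb /=; have := nn0 x ax xb; rewrite /alpha /kappa /w1 /w2 /n.
  by move=> nx0; field.
have EP t : a <= t -> t <= b -> expR (- rho t) * P t = 0.
  move=> at_ tb.
  have /= -> := primitive_density0 _ _ _ _ _ PP _ at_ tb.
    by rewrite phia rhoa oppr0 expR0 v1a v2a; ring.
  move=> x ax xb /=; have := nn0 x ax xb; rewrite /alpha /kappa /w1 /w2 /n.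
  by move=> nx0; field.
exists phi, kappa, Q; split => // t at_ tb.
have Q0 : 0 < Q t by rewrite -(pmulr_rgt0 _ (expR_gt0 (- rho t))) EQ.
have P0 : P t = 0.
  by move/eqP: (EP t at_ tb); rewrite mulf_eq0 gt_eqF ?expR_gt0//= => /eqP.
have cs := cos2Dsin2 (phi t).
split => //.
  have -> : Q t * cos (phi t) = v1 t * (cos (phi t) ^+ 2 + sin (phi t) ^+ 2) +
     sin (phi t) * P t by rewrite /Q /P; ring.
  by rewrite cs P0 mulr1 mulr0 addr0.
have -> : Q t * sin (phi t) = v2 t * (cos (phi t) ^+ 2 + sin (phi t) ^+ 2) -
   cos (phi t) * P t by rewrite /Q /P; ring.
by rewrite cs P0 mulr1 mulr0 subr0.
Qed.

End polar_lift.

(** * Functions with an integrable weak derivative *)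

Section smooth_step.
Context {R : realType}.
Notation mu := (@lebesgue_measure R).
Implicit Types (a b s t r x y e : R) (f g u : R -> R).

(** A remainder bound that is uniform in the sign of [h] gives the derivative of a piecewise
    quadratic function without treating its break points apart. *)
Lemma is_derive_quadratic f x (l : R) :
  (forall h, `|f (h + x) - f x - h * l| <= h ^+ 2) -> is_derive x 1 f l.
Proof.
move=> H.
have D : (fun h => h^-1 *: (f (h *: 1 + x) - f x)) @ 0^' --> l.
  apply/cvgrPdist_le => e e0; near=> h.
  have h0 : h != 0 by near: h; exact: nbhs_dnbhs_neq.
  rewrite -[h *: 1]/(h * 1) mulr1.
  have -> : l - h^-1 *: (f (h + x) - f x) = - h^-1 * (f (h + x) - f x - h * l).
    by rewrite -[h^-1 *: _]/(h^-1 * _); field.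
  rewrite normrM normrN normfV ler_pdivrMl ?normr_gt0//.
  apply: (le_trans (H h)); rewrite -real_normK ?num_real// expr2.
  rewrite ler_pM2l ?normr_gt0//.
  by near: h; exact: dnbhs0_le.
by apply: DeriveDef; [apply/cvg_ex; exists l | exact: cvg_lim].
Unshelve. all: by end_near. Qed.

(** The positive part of [x]; [pos2] is half its square. *)
Let pos x := (x + `|x|) / 2.
Let pos2 x := (x ^+ 2 + x * `|x|) / 4.

Let is_derive_pos2 x : is_derive x 1 pos2 (pos x).
Proof.
apply: is_derive_quadratic => h; rewrite /pos2 /pos ler_norml.
have [hx|hx] := leP 0 (h + x); have [x0|x0] := leP 0 x;
  rewrite ?(ger0_norm hx) ?(ltr0_norm hx) ?(ger0_norm x0) ?(ltr0_norm x0);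
  apply/andP; split; nra.
Qed.

Let pos_continuous : continuous pos.
Proof.
move=> x; apply: cvgM; last exact: cvg_cst.
by apply: cvgD; [exact: cvg_id | exact: norm_continuous].
Qed.

(* [ramp] is a C^1 step from 0 on ]-oo, -1] to 1 on [1, +oo[, with derivative
   [tent]. *)
Definition tent x : R := pos (x + 1) - 2 * pos x + pos (x - 1).
Definition ramp x : R := pos2 (x + 1) - 2 * pos2 x + pos2 (x - 1).

Lemma is_derive_ramp x : is_derive x 1 ramp (tent x).
Proof.
have sh (c : R) y : is_derive y 1 (fun z => pos2 (z + c)) (pos (y + c)).
  rewrite -[pos (y + c)]mulr1.
  apply: (@is_derive1_comp _ pos2 (fun z => z + c)); first exact: is_derive_pos2.
  by apply: is_derive_eq; rewrite addr0.
rewrite /ramp /tent.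
have d2 : is_derive x 1 (fun z => 2 * pos2 z) (2 * pos x).
  exact: (@is_deriveZ _ _ _ pos2 2).
have d1 := sh 1 x; have d3 := sh (- 1) x.
exact: is_deriveD.
Qed.

Lemma tent_continuous : continuous tent.
Proof.
have sh (c : R) y : (fun z => pos (z + c)) @ y --> pos (y + c).
  apply: (cvg_comp _ pos (_ : (fun z => z + c) @ y --> y + c)).
    by apply: cvgD; [exact: cvg_id | exact: cvg_cst].
  exact: pos_continuous.
move=> x; apply: cvgD; last exact: sh.
apply: cvgB; first exact: sh.
by apply: cvgM; [exact: cvg_cst | exact: pos_continuous].
Qed.

Lemma tent_ge0_le1 x : 0 <= tent x <= 1.
Proof.
rewrite /tent /pos.
have [h1|h1] := leP 0 (x + 1); have [h2|h2] := leP 0 x;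
  have [h3|h3] := leP 0 (x - 1);
  rewrite ?(ger0_norm h1) ?(ltr0_norm h1) ?(ger0_norm h2) ?(ltr0_norm h2)
    ?(ger0_norm h3) ?(ltr0_norm h3); apply/andP; split; lra.
Qed.

Lemma tent_out x : 1 <= `|x| -> tent x = 0.
Proof.
rewrite ler_normr /tent /pos => x1.
have [h1|h1] := leP 0 (x + 1); have [h2|h2] := leP 0 x;
  have [h3|h3] := leP 0 (x - 1);
  rewrite ?(ger0_norm h1) ?(ltr0_norm h1) ?(ger0_norm h2) ?(ltr0_norm h2)
    ?(ger0_norm h3) ?(ltr0_norm h3); case/orP: x1 => x1; lra.
Qed.

Lemma ramp_ge0_le1 x : 0 <= ramp x <= 1.
Proof.
rewrite /ramp /pos2.
have [h1|h1] := leP 0 (x + 1); have [h2|h2] := leP 0 x;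
  have [h3|h3] := leP 0 (x - 1);
  rewrite ?(ger0_norm h1) ?(ltr0_norm h1) ?(ger0_norm h2) ?(ltr0_norm h2)
    ?(ger0_norm h3) ?(ltr0_norm h3); apply/andP; split; nra.
Qed.

Lemma ramp_eq0 x : x <= -1 -> ramp x = 0.
Proof.
move=> x1; have h1 : x + 1 <= 0 by lra.
have h2 : x <= 0 by lra.
have h3 : x - 1 <= 0 by lra.
by rewrite /ramp /pos2 (ler0_norm h1) (ler0_norm h2) (ler0_norm h3); ring.
Qed.

Lemma ramp_eq1 x : 1 <= x -> ramp x = 1.
Proof.
move=> x1; have h1 : 0 <= x + 1 by lra.
have h2 : 0 <= x by lra.
have h3 : 0 <= x - 1 by lra.
rewrite /ramp /pos2 (ger0_norm h1) (ger0_norm h2) (ger0_norm h3).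
by field.
Qed.

Lemma is_derive_ramp_scaled s e x : e != 0 ->
  is_derive x 1 (fun r => ramp ((r - s) / e)) (tent ((x - s) / e) / e).
Proof.
move=> e0.
apply: (@is_derive1_comp _ ramp (fun r => (r - s) / e) x _ e^-1).
  exact: is_derive_ramp.
apply: is_derive_eq.
by rewrite !scaler0 ?add0r ?addr0 ?subr0 -[_ *: _]/(_ * _) mulr1.
Qed.

Lemma tent_scaled_continuous s e : continuous (fun r => tent ((r - s) / e) / e).
Proof.
move=> x; apply: cvgM; last exact: cvg_cst.
apply: (cvg_comp _ tent (_ : (fun r => (r - s) / e) @ x --> (x - s) / e)).
  apply: cvgM; last exact: cvg_cst.
  by apply: cvgB; [exact: cvg_id | exact: cvg_cst].
exact: tent_continuous.
Qed.

(** Its derivative is the difference of two averaging kernels of width [e], centred at [s] and at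
    [t]. Used as a test function it thus yields averages of [u] near these two points. *)
Definition bump s t e r : R := ramp ((r - s) / e) - ramp ((r - t) / e).

Lemma is_derive_bump s t e x : e != 0 -> is_derive x 1 (bump s t e)
  (tent ((x - s) / e) / e - tent ((x - t) / e) / e).
Proof.
move=> e0; have := is_derive_ramp_scaled s e x e0.
have := is_derive_ramp_scaled t e x e0 => d1 d2.
exact: is_deriveB.
Qed.

Lemma derive1_bump s t e : e != 0 -> (bump s t e)^`()%classic =
  (fun x => tent ((x - s) / e) / e - tent ((x - t) / e) / e).
Proof.
move=> e0; apply/funext => x; rewrite derive1E.
by have /@derive_val := is_derive_bump s t e x e0.
Qed.

Lemma bump_out s t e r : 0 < e -> s <= t -> r <= s - e \/ t + e <= r ->
  bump s t e r = 0.
Proof.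
move=> e0 st [rs|tr]; rewrite /bump.
  rewrite !ramp_eq0 ?subrr// ler_pdivrMr//; lra.
rewrite !ramp_eq1 ?subrr// ler_pdivlMr//; lra.
Qed.

Lemma bump_in s t e r : 0 < e -> s + e <= r -> r <= t - e -> bump s t e r = 1.
Proof.
move=> e0 sr rt; rewrite /bump ramp_eq1 ?ramp_eq0 ?subr0//.
  by rewrite ler_pdivrMr//; lra.
by rewrite ler_pdivlMr//; lra.
Qed.

Lemma bump_norm_le1 s t e r : `|bump s t e r| <= 1.
Proof.
rewrite /bump ler_norml; have /andP[] := ramp_ge0_le1 ((r - s) / e).
by have /andP[] := ramp_ge0_le1 ((r - t) / e) => *; apply/andP; split; lra.
Qed.

Lemma bump_test_function a b s t e : 0 < e -> s <= t -> a < s - e ->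
  t + e < b -> test_function a b (bump s t e).
Proof.
move=> e0 st as_ tb; have en0 : e != 0 by rewrite gt_eqF.
have sub : closure [set r | bump s t e r != 0] `<=` `[s - e, t + e]%classic.
  have cl : closed `[s - e, t + e]%classic by exact: interval_closed.
  rewrite [X in _ `<=` X]((closure_id _).1 cl).
  apply: closureS => r /= br; rewrite in_itv/=; apply/andP; split.
    by rewrite leNgt; apply: contraNN br => rs; rewrite bump_out//; left; exact: ltW.
  by rewrite leNgt; apply: contraNN br => rs; rewrite bump_out//; right; exact: ltW.
split.
- by move=> r; have [] := is_derive_bump s t e r en0.
- rewrite derive1_bump// => x; apply: cvgB; exact: tent_scaled_continuous.
- apply: subclosed_compact sub; first exact: closed_closure.
  exact: segment_compact.
- apply: (subset_trans sub) => r /=; rewrite !in_itv/= => /andP[sr rt].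
  by rewrite (lt_le_trans as_)//= (le_lt_trans rt).
Qed.

End smooth_step.

(** * Increments of a function between Lebesgue points *)

Section weak_derivative_increment.
Context {R : realType}.
Notation mu := (@lebesgue_measure R).
Implicit Types (a b s t r : R) (f g u : R -> R).

Lemma integrableT_itv s t f : mu.-integrable setT (EFin \o f) ->
  mu.-integrable `[s, t] (EFin \o f).
Proof. exact: integrableS. Qed.

Lemma integrable_continuous_itv s t f : {within `[s, t], continuous f} ->
  mu.-integrable `[s, t] (EFin \o f).
Proof. exact: continuous_compact_integrable (@segment_compact _ _ _). Qed.

Lemma integrable_cst_itv s t (c : R) :
  mu.-integrable `[s, t] (EFin \o (fun=> c)).
Proof.
by apply: integrable_continuous_itv => x; exact: cvg_cst.
Qed.

Lemma lebesgue_pt_norm_integral u s (eta : R) :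
  mu.-integrable setT (EFin \o u) -> lebesgue_pt u s -> 0 < eta ->
  exists2 d : R, 0 < d & forall e : R, 0 < e -> e < d ->
    \int[mu]_(r in `[s - e, s + e]) `|u r - u s| <= eta * e.
Proof.
move=> ui /fine_cvgP[fin cv] eta0.
(* The average is taken over a ball of length [2 * e], hence the factor 2. *)
have eta20 : 0 < eta / 2 by rewrite divr_gt0.
have : \forall e \near (0:R)^'+, (davg u s e < (eta / 2)%:E)%E.
  near=> e.
  have fe : davg u s e \is a fin_num by near: e.
  rewrite -(fineK fe) lte_fin; near: e.
  move/cvgrPdist_lt : cv => /(_ _ eta20); apply: filterS => e /=.
  by rewrite sub0r normrN => /(le_lt_trans (ler_norm _)).
move=> [d /= d0 Hd]; exists d => // e e0 ed.
have := Hd e; rewrite /= sub0r normrN gtr0_norm// => /(_ ed e0).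
have mB : measurable (ball s e) by exact: measurable_ball.
rewrite /davg /iavg lebesgue_measure_ball ?(ltW e0)//.
have e20 : 0 < e *+ 2 by rewrite mulrn_wgt0.
rewrite inver gt_eqF// lte_pdivrMl// ball_itv.
have vi : mu.-integrable `[s - e, s + e] (EFin \o (fun r => u r - u s)).
  exact: (integrableB _ (integrableT_itv _ _ _ ui) (integrable_cst_itv _ _ _)).
have vi' : mu.-integrable `[s - e, s + e] (EFin \o (fun r => `|u r - u s|)).
  exact: integrable_norm.
pose v r := `|u r - u s|.
have -> : (\int[mu]_(y in `](s - e)%R, (s + e)%R[) `|((center (u s) \o u) y)%:E|
   = \int[mu]_(y in `[(s - e)%R, (s + e)%R]) (v y)%:E)%E.
  have mv : measurable_fun `[s - e, s + e] (EFin \o v).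
    by have /integrableP[] := vi'.
  rewrite -integral_itv_bndo_bndc; last first.
    by apply: measurable_funS mv => //; apply: subset_itv; rewrite bnd_simp.
  rewrite -integral_itv_obnd_cbnd; last first.
    by apply: measurable_funS mv => //; apply: subset_itv; rewrite bnd_simp.
  by [].
rewrite -[X in (X < _)%E]fineK; last exact: integrable_fin_num.
move=> /ltW; rewrite -EFinM lee_fin => /le_trans; apply.
by rewrite -mulr_natl; lra.
Unshelve. all: by end_near. Qed.

Lemma Rintegral_supp s t f : (forall r, r < s \/ t < r -> f r = 0) ->
  \int[mu]_r f r = \int[mu]_(r in `[s, t]) f r.
Proof.
move=> f0; rewrite [RHS]Rintegral_mkcond; apply: eq_Rintegral => r _.
rewrite patchE; case: ifPn => //; rewrite notin_setE/= in_itv/= => rst.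
by apply: f0; move/negP: rst; rewrite negb_and -!ltNge => /orP.
Qed.

Lemma Rintegral_tent s (e : R) : 0 < e ->
  \int[mu]_(r in `[s - e, s + e]) (tent ((r - s) / e) / e) = 1.
Proof.
move=> e0; have en0 : e != 0 by rewrite gt_eqF.
have d r : is_derive r 1 (fun r => ramp ((r - s) / e)) (tent ((r - s) / e) / e).
  exact: is_derive_ramp_scaled.
have cr : continuous (fun r => ramp ((r - s) / e)).
  move=> r; apply: differentiable_continuous; apply/derivable1_diffP.
  exact: ex_derive.
rewrite /Rintegral (@continuous_FTC2 _ _ (fun r => ramp ((r - s) / e))).
- have -> : (s + e - s) / e = 1 by field.
  have -> : (s - e - s) / e = - 1 by field.
  by rewrite ramp_eq1// ramp_eq0// -EFinB subr0.
- lra.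
- exact/continuous_subspaceT/tent_scaled_continuous.
- split.
  + by move=> r _; exact: ex_derive.
  + exact/cvg_at_right_filter/cr.
  + exact/cvg_at_left_filter/cr.
- by move=> r _; rewrite derive1E; exact: derive_val.
Qed.

(** The kernel has integral 1 and is at most [e^-1], so the error is at most [e^-1] times the
    integral of [|u r - u s|], which is small at a Lebesgue point. *)
Lemma tent_average u s (eta : R) :
  mu.-integrable setT (EFin \o u) -> lebesgue_pt u s -> 0 < eta ->
  exists2 d : R, 0 < d & forall e : R, 0 < e -> e < d ->
    `|\int[mu]_r (u r * (tent ((r - s) / e) / e)) - u s| <= eta.
Proof.
move=> ui us eta0; have [d d0 Hd] := lebesgue_pt_norm_integral u s eta ui us eta0.
exists d => // e e0 ed; have en0 : e != 0 by rewrite gt_eqF.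
pose T r := tent ((r - s) / e) / e.
rewrite (@Rintegral_supp (s - e) (s + e)); last first.
  move=> r rs; rewrite tent_out ?mul0r ?mulr0//.
  rewrite normrM normfV (gtr0_norm e0) ler_pdivlMr// mul1r ler_normr.
  by case: rs => ?; apply/orP; [right | left]; lra.
have cT : {within `[s - e, s + e], continuous T}.
  exact/continuous_subspaceT/tent_scaled_continuous.
have ci := integrable_cst_itv (s - e) (s + e) (u s).
have uI := integrableT_itv (s - e) (s + e) u ui.
have uTi := integrable_continuousM _ _ _ _ cT uI.
have vi : mu.-integrable `[s - e, s + e] (EFin \o (fun r => u r - u s)).
  exact: (integrableB _ uI ci).
have vTi := integrable_continuousM _ _ _ _ cT vi.
have Ti := integrable_continuous_itv _ _ _ cT.
have -> : \int[mu]_(r in `[s - e, s + e]) (u r * (tent ((r - s) / e) / e)) - u s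
   = \int[mu]_(r in `[s - e, s + e]) ((u r - u s) * T r).
  rewrite -[X in _ - X]mulr1 -(Rintegral_tent s e e0) -RintegralZl//.
  rewrite -RintegralB//.
    by apply: eq_Rintegral => r _; rewrite /T; ring.
  by apply: (integrableZl _ _ Ti).
apply: (@le_trans _ _ (e^-1 * \int[mu]_(r in `[s - e, s + e]) `|u r - u s|)).
  apply: norm_Rintegral_le => //; first exact: integrable_norm.
  move=> r _ _; rewrite normrM mulrC ler_wpM2r//.
  have /andP[T0 T1] := @tent_ge0_le1 R ((r - s) / e).
  rewrite /T normrM normfV (gtr0_norm e0) ger0_norm//.
  by rewrite ler_pdivrMr// mulVf.
by rewrite ler_pdivrMl// mulrC; exact: Hd.
Qed.

(** The bump differs from the indicator of the interval only on the two transition zones, whose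
    measure tends to 0; the integral of [|g|] over them does too. *)
Lemma bump_integral g s t (eta : R) :
  mu.-integrable setT (EFin \o g) -> s < t -> 0 < eta ->
  exists2 d : R, 0 < d & forall e : R, 0 < e -> e < d ->
    `|\int[mu]_r (g r * bump s t e r) - \int[mu]_(r in `[s, t]) g r| <= eta.
Proof.
move=> gi st eta0.
have eta20 : 0 < eta / 2 by rewrite divr_gt0.
have [d [d0 Hd]] := integral_normr_continuous gi eta20.
(* The two transition zones have total length at most [4 * e]. The factor 2 in [eta / 2] is spent on
   the bound [|k r - l r| <= 2 * |g r|]. *)
exists (d / 4); first by rewrite divr_gt0.
move=> e e0 ed; have en0 : e != 0 by rewrite gt_eqF.
pose I1 := `[s - e, s + e]%classic; pose I2 := `[t - e, t + e]%classic.
pose A := I1 `|` I2.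
have mI1 : measurable I1 by exact: measurable_itv.
have mI2 : measurable I2 by exact: measurable_itv.
have mA : measurable A by exact: measurableU.
have muA : (mu A < d%:E)%E.
  apply: (@le_lt_trans _ _ (mu I1 + mu I2)%E); first exact: measureU2.
  rewrite /I1 /I2 !lebesgue_measure_itv/= !lte_fin !ifT; [|lra|lra].
  by rewrite -!EFinD lte_fin; lra.
have {}Hd := Hd A mA muA.
have cb : continuous (bump s t e).
  move=> r; apply: differentiable_continuous; apply/derivable1_diffP.
  by have [] := is_derive_bump s t e r en0.
have mb : measurable_fun setT (bump s t e) by exact: continuous_measurable_fun.
pose k r := g r * bump s t e r; pose l := g \_ `[s, t].
have ki : mu.-integrable setT (EFin \o k).
  apply: (integrableMl _ gi mb) => //.
  exists 1; split => // x x1 r _; apply: (le_trans (bump_norm_le1 _ _ _ _)).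
  exact: ltW.
have li : mu.-integrable setT (EFin \o l).
  rewrite -restrict_EFin; apply/(integrable_mkcond _ _).1 => //.
  exact: integrableT_itv.
have -> : \int[mu]_r (g r * bump s t e r) - \int[mu]_(r in `[s, t]) g r =
    \int[mu]_(r in A) (k r - l r).
  rewrite [X in _ - X]Rintegral_mkcond -RintegralB// [RHS]Rintegral_mkcond.
  apply: eq_Rintegral => r _; rewrite [RHS]patchE; case: ifPn => //.
  rewrite notin_setE/= /A /I1 /I2/= !in_itv/= => rA; rewrite /l patchE mem_setE in_itv/=.
  have [rs|sr] := ltP r s.
    rewrite bump_out ?mulr0 ?subrr ?(ltW st)//; left; rewrite leNgt.
    by apply/negP => h; apply: rA; left; apply/andP; split; lra.
  have [tr|rt] := ltP t r.
    rewrite bump_out ?mulr0 ?subrr ?(ltW st)//; right; rewrite leNgt.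
    by apply/negP => h; apply: rA; right; apply/andP; split; lra.
  rewrite bump_in ?mulr1 ?subrr//.
    by rewrite leNgt; apply/negP => h; apply: rA; left; apply/andP; split; lra.
  by rewrite leNgt; apply/negP => h; apply: rA; right; apply/andP; split; lra.
have kl : mu.-integrable setT (EFin \o (fun r => k r - l r)).
  exact: (integrableB _ ki li).
apply: (le_trans (le_normr_Rintegral _ _)) => //.
  exact: integrableS kl.
apply: (@le_trans _ _ (2 * \int[mu]_(r in A) `|g r|)); last lra.
have gA : mu.-integrable A (EFin \o (fun r => `|g r|)).
  by apply: integrable_norm; exact: integrableS gi.
rewrite -RintegralZl//; apply: le_Rintegral => //.
- by apply: integrable_norm; exact: integrableS kl.
- by apply: (integrableZl _ _ gA).
move=> r _; apply: (le_trans (ler_normB _ _)).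
have h1 : `|k r| <= `|g r|.
  by rewrite /k normrM ler_piMr// bump_norm_le1.
have h2 : `|l r| <= `|g r|.
  by rewrite /l patchE; case: ifP => // _; rewrite normr0.
by have := normr_ge0 (g r); lra.
Qed.

(* Testing against [bump s t e], a C^1 approximation of the indicator of
   [s, t], and letting [e] tend to 0 makes the du Bois-Reymond lemma
   unnecessary. *)
Lemma weak_derivative_increment a b u g s t :
  a < s -> s < t -> t < b -> L1 a b u -> L1 a b g -> weak_derivative a b u g ->
  lebesgue_pt (u \_ `]a, b[) s -> lebesgue_pt (u \_ `]a, b[) t ->
  u t - u s = \int[mu]_(r in `[s, t]) g r.
Proof.
move=> as_ st tb ui gi ug ls lt.
pose u0 := u \_ `]a, b[; pose g0 := g \_ `]a, b[.
have u0i : mu.-integrable setT (EFin \o u0).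
  by rewrite -restrict_EFin; apply/(integrable_mkcond _ _).1.
have g0i : mu.-integrable setT (EFin \o g0).
  by rewrite -restrict_EFin; apply/(integrable_mkcond _ _).1.
have u0E r : a < r -> r < b -> u0 r = u r.
  by move=> ar rb; rewrite /u0 patchE mem_setE in_itv/= ar rb.
have -> : \int[mu]_(r in `[s, t]) g r = \int[mu]_(r in `[s, t]) g0 r.
  apply: eq_Rintegral => r; rewrite inE/= in_itv/= => /andP[sr rt].
  by rewrite /g0 patchE mem_setE in_itv/= (lt_le_trans as_ sr) (le_lt_trans rt tb).
rewrite -(u0E t) ?(lt_trans as_)// -(u0E s) ?(lt_trans st)//.
apply/eqP; rewrite -subr_eq0 -normr_le0; apply/ler_addgt0Pl => eta eta0.
have eta3 : 0 < eta / 3 by rewrite divr_gt0.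
have [d1 d10 H1] := tent_average u0 s (eta / 3) u0i ls eta3.
have [d2 d20 H2] := tent_average u0 t (eta / 3) u0i lt eta3.
have [d3 d30 H3] := bump_integral g0 s t (eta / 3) g0i st eta3.
have [e [e0 e1 e2 e3 [es et]]] : exists e : R,
    [/\ 0 < e, e < d1, e < d2, e < d3 & e < s - a /\ e < b - t].
  pose m := Num.min (Num.min d1 (Num.min d2 d3)) (Num.min (s - a) (b - t)).
  have m0 : 0 < m by rewrite !lt_min !subr_gt0 d10 d20 d30 as_ tb.
  have mE : m / 2 < m by rewrite ltr_pdivrMr// ltr_pMr// ltr1n.
  exists (m / 2); split; rewrite ?divr_gt0//; try split;
    by rewrite (lt_le_trans mE)// !ge_min lexx ?orbT.
have en0 : e != 0 by rewrite gt_eqF.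
have tf : test_function a b (bump s t e).
  by apply: bump_test_function; lra.
(* The minus sign of the weak formulation compensates the order of the kernels: the average at [t]
   minus the average at [s] is the integral of [g] against the bump. *)
have := ug _ tf; rewrite derive1_bump//.
pose S r := u0 r * (tent ((r - s) / e) / e).
pose T r := u0 r * (tent ((r - t) / e) / e).
have int (c : R) : mu.-integrable setT
    (EFin \o (fun r => u0 r * (tent ((r - c) / e) / e))).
  pose W r := tent ((r - c) / e) / e.
  have mW : measurable_fun setT W.
    by apply: continuous_measurable_fun; exact: tent_scaled_continuous.
  have bW : [bounded W r | r in setT].
    exists e^-1; split; first exact: num_real.
    move=> x ex r _; apply: (le_trans _ (ltW ex)).
    have /andP[T0 T1] := @tent_ge0_le1 R ((r - c) / e).
    rewrite /W normrM normfV (gtr0_norm e0) ger0_norm//.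
    by rewrite ler_pdivrMr// mulVf.
  exact: (integrableMl _ u0i mW bW).
have -> : \int[mu]_(r in `]a, b[)
    (u r * (tent ((r - s) / e) / e - tent ((r - t) / e) / e)) =
    \int[mu]_r S r - \int[mu]_r T r.
  rewrite -RintegralB; [|by []|exact: int|exact: int].
  rewrite Rintegral_mkcond; apply: eq_Rintegral => r _.
  by rewrite /S /T /u0 !patchE; case: ifP => _ /=; rewrite ?mulrBr ?mul0r ?subrr.
have -> : \int[mu]_(r in `]a, b[) (g r * bump s t e r) =
    \int[mu]_r (g0 r * bump s t e r).
  rewrite Rintegral_mkcond; apply: eq_Rintegral => r _.
  by rewrite /g0 !patchE; case: ifP => _; rewrite ?mul0r.
move: (H1 e e0 e1) (H2 e e0 e2) (H3 e e0 e3).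
rewrite -/(Rintegral mu setT S) -/(Rintegral mu setT T).
move: (Rintegral mu setT S) (Rintegral mu setT T) (Rintegral mu setT _)
  (Rintegral mu _ _) => x y z w.
rewrite !ler_norml addr0 => /andP[? ?] /andP[? ?] /andP[? ?] ?.
by apply/andP; split; lra.
Qed.

End weak_derivative_increment.

(** * Continuous representatives of weak derivatives *)

Section sobolev_regularity.
Context {R : realType}.
Notation mu := (@lebesgue_measure R).
Implicit Types (a b s t r : R) (f g u h G : R -> R).

Lemma within_interior_continuous a b u t : a < t -> t < b ->
  {within `[a, b], continuous u} -> {for t, continuous u}.
Proof.
move=> at_ tb cu; have ab : a < b by exact: lt_trans tb.
have [+ _ _] := (continuous_within_itvP u ab).1 cu.
by apply; rewrite in_itv/= at_ tb.
Qed.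

Lemma within_const_closure a b u (c : R) : a < b ->
  {within `[a, b], continuous u} ->
  (forall t, a < t -> t < b -> u t = c) ->
  forall t, a <= t -> t <= b -> u t = c.
Proof.
move=> ab cu uc t at_ tb; apply/eqP; rewrite -subr_eq0 -normr_le0.
apply/ler_addgt0Pl => e e0; rewrite addr0.
have [d d0 Hd] := within_itv_ballP _ _ _ _ cu at_ tb _ e0.
have [s [as_ sb std]] : exists s : R, [/\ a < s, s < b & `|s - t| < d].
  have [ta|ta] := eqVneq t a.
    exists (Num.min ((a + b) / 2) (a + d / 2)).
    have h1 : a < (a + b) / 2 by lra.
    have h2 : a < a + d / 2 by lra.
    have h3 : (a + b) / 2 < b by lra.
    have h4 : a + d / 2 < a + d by lra.
    have m1 : a < Num.min ((a + b) / 2) (a + d / 2) by rewrite lt_min h1 h2.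
    split; first exact: m1.
      by rewrite gt_min h3.
    have m2 : Num.min ((a + b) / 2) (a + d / 2) < a + d by rewrite gt_min h4 orbT.
    by rewrite ta gtr0_norm ?subr_gt0// ltrBlDl.
  have at' : a < t by rewrite lt_neqAle eq_sym ta.
  exists (Num.max ((a + t) / 2) (t - d / 2)).
  have h1 : a < (a + t) / 2 by lra.
  have h2 : (a + t) / 2 < t by lra.
  have h3 : t - d / 2 < t by lra.
  have h4 : t - d < t - d / 2 by lra.
  have m1 : Num.max ((a + t) / 2) (t - d / 2) < t by rewrite gt_max h2 h3.
  have m2 : t - d < Num.max ((a + t) / 2) (t - d / 2) by rewrite lt_max h4 orbT.
  split; first by rewrite lt_max h1.
    exact: lt_le_trans tb.
  by rewrite ltr0_norm ?subr_lt0// opprB ltrBlDr -ltrBlDl.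
rewrite -(uc s)// distrC; apply/ltW/Hd => //; exact: ltW.
Qed.

(** [G] is the continuous representative of [g]: the increment formula makes [g] equal, at its
    Lebesgue points, to a primitive of [h]. The same formula for [u] then holds with [g] replaced by
    [G] under the integral. *)
Lemma sobolev_primitive a b u g h : a < b -> {within `[a, b], continuous u} ->
  L1 a b u -> weak_derivative a b u g -> L1 a b g ->
  weak_derivative a b g h -> L1 a b h ->
  exists G, primitive a b u G /\ primitive a b G (h \_ `]a, b[).
Proof.
move=> ab cu ui ug gi gh hi.
pose h0 := h \_ `]a, b[; pose g0 := g \_ `]a, b[.
have h0i : mu.-integrable `[a, b] (EFin \o h0).
  apply: integrableT_itv.
  by rewrite -restrict_EFin; apply/(integrable_mkcond _ _).1.
have aeL : {ae mu, forall t, lebesgue_pt g0 t}.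
  by apply: lebesgue_differentiation; exact: integrable_locally_restrict.
(* A Lebesgue point of [g0] serves to fix the constant of integration in [G]; one exists because the
   open interval is not negligible. *)
have [s0 [as0 s0b ls0]] : exists s, [/\ a < s, s < b & lebesgue_pt g0 s].
  apply: contrapT => no.
  have : mu.-negligible `]a, b[%classic.
    apply: negligibleS aeL => t /=; rewrite in_itv/= => /andP[at_ tb] lt.
    by apply: no; exists t.
  move=> neg; have : mu `]a, b[%classic = 0%E by exact: measure_negligible.
  rewrite lebesgue_measure_itv/= lte_fin ab -EFinB => /eqP.
  by rewrite eqe subr_eq0 gt_eqF.
pose H t := \int[mu]_(r in `[a, t]) h0 r.
have PH : primitive a b H h0 by exact: integral_primitive.
pose G t := (g s0 - H s0) + H t.
have PG : primitive a b G h0 by exact: primitive_addl.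
have incr s t : a < s -> s < t -> t < b -> lebesgue_pt g0 s -> lebesgue_pt g0 t ->
    g t - g s = H t - H s.
  move=> as_ st tb ls lt.
  rewrite (@weak_derivative_increment _ a b g h s t)//.
  rewrite PH.2 ?(ltW as_) ?(ltW st) ?(ltW tb)//.
  apply: eq_Rintegral => r; rewrite inE/= in_itv/= => /andP[sr rt].
  by rewrite /h0 patchE mem_setE in_itv/= (lt_le_trans as_ sr) (le_lt_trans rt tb).
have gG t : a < t -> t < b -> lebesgue_pt g0 t -> g t = G t.
  move=> at_ tb lt; rewrite /G; have [ts|st|<-] := ltgtP t s0.
  - have := incr t s0 at_ ts s0b lt ls0; lra.
  - have := incr s0 t as0 st tb ls0 lt; lra.
  - lra.
have cG := primitive_continuous _ _ _ _ (ltW ab) PG.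
have Gi := integrable_continuous_itv _ _ _ cG.
pose U t := \int[mu]_(r in `[a, t]) G r.
have PU : primitive a b U G by exact: integral_primitive.
(* Continuity of [u] makes every interior point a Lebesgue point, so its increment formula has no
   exceptional set. *)
have lu t : a < t -> t < b -> lebesgue_pt (u \_ `]a, b[) t.
  move=> at_ tb; apply: (@continuous_lebesgue_pt _ _ _ `]a, b[%classic).
  - split; first exact: interval_open.
    by rewrite /= in_itv/= at_ tb.
  - exact: measurable_itv.
  - have /integrableP[/measurable_EFinP mu_ _] := ui.
    apply: eq_measurable_fun mu_ => x xab.
    by rewrite patchE xab.
  - have cut := within_interior_continuous _ _ _ _ at_ tb cu.
    have tab : t \in `]a, b[ by rewrite in_itv/= at_ tb.
    rewrite /prop_for /continuous_at patchE mem_setE tab.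
    apply: cvg_trans cut; apply: near_eq_cvg; near=> r.
    rewrite patchE mem_setE ifT//; near: r.
    exact: near_in_itvoo.
have uinc s t : a < s -> s < t -> t < b -> u t - u s = U t - U s.
  move=> as_ st tb; rewrite (@weak_derivative_increment _ a b u g s t)//; last 2 first.
  - by apply: lu => //; exact: lt_trans tb.
  - by apply: lu => //; exact: lt_trans st.
  rewrite PU.2 ?(ltW as_) ?(ltW st) ?(ltW tb)//; congr fine.
  have sub : `[s, t]%classic `<=` `]a, b[%classic.
    by apply: subset_itv; rewrite bnd_simp.
  apply: ae_eq_integral => //.
  - by have /integrableP[mg _] := gi; exact: measurable_funS mg.
  - have /integrableP[mG _] := integrable_subitv _ _ s t _ Gi (ltW as_) (ltW tb).
    exact: mG.
  - move: aeL; apply: filterS; first exact: (ae_filter_ringOfSetsType mu).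
    move=> r lr; rewrite /= in_itv/= => /andP[sr rt].
    by rewrite gG// ?(lt_le_trans as_)// (le_lt_trans rt).
exists G; split => //; split => // s t as_ st tb.
rewrite -PU.2//.
(* The increment formula is known inside the interval only; [P] is constant there, and continuity
   carries this to the endpoints. *)
pose P r := u r - U r.
have cP : {within `[a, b], continuous P}.
  move=> r; apply: cvgB; first exact: cu.
  exact: (primitive_continuous _ _ _ _ (ltW ab) PU).
pose m := (a + b) / 2.
have am : a < m by rewrite /m; lra.
have mb : m < b by rewrite /m; lra.
have Pc r : a <= r -> r <= b -> P r = P m.
  apply: within_const_closure => // {}r ar rb; rewrite /P.
  have [rm|mr|->//] := ltgtP r m.
  - by have := uinc r m ar rm mb; lra.
  - by have := uinc m r am mr rb; lra.
have := Pc t (le_trans as_ st) tb; have := Pc s as_ (le_trans st tb).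
by rewrite /P; lra.
Unshelve. all: by end_near. Qed.

End sobolev_regularity.

(** * Regular arcs *)

Section one_sided_derivatives.
Context {R : realType}.
Notation mu := (@lebesgue_measure R).
Implicit Types (a b s t r : R) (f g u h G : R -> R) (c : R -> 'rV[R]_2).

(** This first-order expansion is relative to the closed interval, so that it also covers the
    endpoints, where only one-sided derivatives make sense. *)
Lemma primitive_diff a b u G r (eta : R) : primitive a b u G ->
  {within `[a, b], continuous G} -> a <= r -> r <= b -> 0 < eta ->
  exists2 d : R, 0 < d & forall t, a <= t -> t <= b -> `|t - r| < d ->
    `|u t - u r - G r * (t - r)| <= eta * `|t - r|.
Proof.
move=> uG cG ar rb eta0.
have [d d0 Hd] := within_itv_ballP _ _ _ _ cG ar rb _ eta0.
have key s t : a <= s -> s <= t -> t <= b ->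
    (forall x, s <= x -> x <= t -> `|x - r| < d) ->
    `|u t - u s - G r * (t - s)| <= eta * (t - s).
  move=> as_ st tb std.
  have cI := integrable_cst_itv s t (G r).
  have GI := integrable_subitv _ _ s t _ uG.1 as_ tb.
  have tsE (k : R) : \int[mu]_(x in `[s, t]) k = k * (t - s).
    have muE : mu `[s, t]%classic = (t - s)%:E.
      rewrite lebesgue_measure_itv/= lte_fin.
      have [->|ts] := eqVneq s t; first by rewrite ltxx subrr.
      by rewrite lt_neqAle ts st -EFinB.
    by rewrite Rintegral_cst// (congr1 fine muE).
  rewrite uG.2// -tsE -RintegralB// -[X in eta * X]mul1r -tsE.
  apply: norm_Rintegral_le => //.
  - exact: (integrableB _ GI cI).
  - exact: integrable_cst_itv.
  - move=> x sx xt; rewrite mulr1; apply/ltW/Hd; last exact: std.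
      exact: le_trans sx.
    exact: le_trans tb.
exists d => // t at_ tb trd; have [rt|/ltW tr] := leP r t.
  rewrite (ger0_norm (_ : 0 <= t - r)) ?subr_ge0//; apply: key => // x rx xt.
  rewrite ger0_norm ?subr_ge0//; apply: le_lt_trans trd.
  by apply: le_trans (ler_norm _); exact: lerB.
have -> : u t - u r - G r * (t - r) = - (u r - u t - G r * (r - t)) by ring.
rewrite normrN [X in eta * X]distrC (ger0_norm (_ : 0 <= r - t)) ?subr_ge0//.
apply: key => // x tx xr.
rewrite distrC ger0_norm ?subr_ge0//; apply: le_lt_trans trd.
by rewrite distrC; apply: le_trans (ler_norm _); exact: lerB.
Qed.

Lemma cvg_mx {T : Type} {m n : nat} {F : set_system T} {FF : Filter F}
    (f : T -> 'M[R]_(m, n)) (l : 'M[R]_(m, n)) :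
  (forall i j, f x i j @[x --> F] --> l i j) -> f @ F --> l.
Proof.
move=> fl; apply/cvgrPdist_le => e e0; near=> x.
rewrite [leLHS]/Num.Def.normr/= mx_normrE (bigmax_le _ (ltW e0))//= => ij _.
rewrite !mxE; move: ij; near: x; apply: filter_forall => ij.
exact: ((cvgrPdist_le _ _).1 (fl ij.1 ij.2)).
Unshelve. all: by end_near. Qed.

(** The filter is left abstract in order to treat left, right and two-sided derivatives at once. *)
Lemma primitive_quotient_cvg a b c (v : R -> 'rV[R]_2) r (F : set_system R)
    {FF : Filter F} :
  (forall j, primitive a b (fun t => c t 0 j) (fun t => v t 0 j)) ->
  (forall j, {within `[a, b], continuous (fun t => v t 0 j)}) ->
  a <= r -> r <= b ->
  (forall d : R, 0 < d -> \forall x \near F,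
    [/\ x != 0, `|x| < d, a <= r + x & r + x <= b]) ->
  x^-1 *: (c (r + x) - c r) @[x --> F] --> v r.
Proof.
move=> cv vc ar rb HF; apply: cvg_mx => i j; rewrite ord1 {i}.
apply/cvgrPdist_le => e e0.
have [d d0 Hd] := primitive_diff _ _ _ _ _ _ (cv j) (vc j) ar rb e0.
apply: filterS (HF d d0) => x [x0 xd arx rxb].
rewrite !mxE; have := Hd (r + x) arx rxb.
rewrite addrAC subrr add0r => /(_ xd) H.
have -> : v r 0 j - x^-1 * (c (r + x) 0 j - c r 0 j) =
   - x^-1 * (c (r + x) 0 j - c r 0 j - v r 0 j * x) by field.
by rewrite normrM normrN normfV ler_pdivrMl ?normr_gt0// [leRHS]mulrC.
Qed.

Lemma primitive_rderiv a b c (v : R -> 'rV[R]_2) r :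
  (forall j, primitive a b (fun t => c t 0 j) (fun t => v t 0 j)) ->
  (forall j, {within `[a, b], continuous (fun t => v t 0 j)}) ->
  a <= r -> r < b -> rderiv c r = v r.
Proof.
move=> cv vc ar rb; apply: cvg_lim; first exact: norm_hausdorff.
apply: (primitive_quotient_cvg a b) => // [|d d0]; first exact: ltW.
near=> x; have x0 : 0 < x by near: x; exact: nbhs_right_gt.
split.
- by rewrite gt_eqF.
- by rewrite gtr0_norm//; near: x; exact: nbhs_right_lt.
- by rewrite (le_trans ar)// lerDl ltW.
- by rewrite -lerBrDl; near: x; apply: nbhs_right_le; rewrite subr_gt0.
Unshelve. all: by end_near. Qed.

Lemma primitive_lderiv a b c (v : R -> 'rV[R]_2) r :
  (forall j, primitive a b (fun t => c t 0 j) (fun t => v t 0 j)) ->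
  (forall j, {within `[a, b], continuous (fun t => v t 0 j)}) ->
  a < r -> r <= b -> lderiv c r = v r.
Proof.
move=> cv vc ar rb; apply: cvg_lim; first exact: norm_hausdorff.
apply: (primitive_quotient_cvg a b) => // [|d d0]; first exact: ltW.
near=> x; have x0 : x < 0 by near: x; exact: nbhs_left_lt.
split.
- by rewrite lt_eqF.
- by rewrite ltr0_norm// ltrNl; near: x; apply: nbhs_left_gt; rewrite oppr_lt0.
- rewrite -lerBlDl; near: x; apply: nbhs_left_ge; rewrite subr_lt0//.
- by rewrite (le_trans _ rb)// gerDl ltW.
Unshelve. all: by end_near. Qed.

Lemma primitive_is_derive a b c (v : R -> 'rV[R]_2) r :
  (forall j, primitive a b (fun t => c t 0 j) (fun t => v t 0 j)) ->
  (forall j, {within `[a, b], continuous (fun t => v t 0 j)}) ->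
  a < r -> r < b -> is_derive r 1 c (v r).
Proof.
move=> cv vc ar rb.
have E : (fun x : R => x^-1 *: (c (x *: 1 + r) - c r)) =
    (fun x : R => x^-1 *: (c (r + x) - c r)).
  by apply/funext => x; rewrite -[x *: 1]/(x * 1) mulr1 [x + r]addrC.
have D : x^-1 *: (c (x *: 1 + r) - c r) @[x --> (0 : R)^'] --> v r; last first.
  apply: DeriveDef; first by apply/cvg_ex; exists (v r).
  by apply: cvg_lim; first exact: norm_hausdorff.
rewrite E; apply: (primitive_quotient_cvg a b) => // [||d d0]; [exact: ltW|exact: ltW|].
near=> x; have xm : `|x| < Num.min (r - a) (b - r).
  by near: x; apply: dnbhs0_lt; rewrite lt_min !subr_gt0 ar rb.
move: xm; rewrite lt_min => /andP[/ltr_normlP[xa _] /ltr_normlP[_ xb]].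
split.
- by near: x; exact: nbhs_dnbhs_neq.
- by near: x; exact: dnbhs0_lt.
- lra.
- lra.
Unshelve. all: by end_near. Qed.

End one_sided_derivatives.

(** * The tangent angle of a regular arc *)

Section regular_arcs.
Context {R : realType}.
Notation mu := (@lebesgue_measure R).
Implicit Types (a b s t r : R) (phi kappa Q : R -> R) (c : R -> 'rV[R]_2).

Definition expi (u : R) : 'rV[R]_2 := \row_j (if j == 0 then cos u else sin u).

Lemma dotE (u v : 'rV[R]_2) : dot u v = u 0 0 * v 0 0 + u 0 1 * v 0 1.
Proof.
by rewrite /dot big_ord_recl big_ord1; congr (_ + u 0 _ * v 0 _); apply/val_inj.
Qed.

Lemma expi0 (u : R) : expi u 0 0 = cos u. Proof. by rewrite mxE. Qed.

Lemma expi1 (u : R) : expi u 0 1 = sin u. Proof. by rewrite mxE. Qed.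

Lemma dot_expi (u v : R) : dot (expi u) (expi v) = cos (u - v).
Proof. by rewrite dotE !expi0 !expi1 cosB. Qed.

Lemma dotZl (k : R) (u v : 'rV[R]_2) : dot (k *: u) v = k * dot u v.
Proof. by rewrite !dotE !mxE; ring. Qed.

Lemma dotZr (k : R) (u v : 'rV[R]_2) : dot u (k *: v) = k * dot u v.
Proof. by rewrite !dotE !mxE; ring. Qed.

Lemma enorm_expi (q u : R) : 0 < q -> enorm (q *: expi u) = q.
Proof.
move=> q0; rewrite /enorm dotZl dotZr dot_expi subrr cos0 mulr1 -expr2.
by rewrite sqrtr_sqr gtr0_norm.
Qed.

Lemma ord2_cases (j : 'I_2) : j = 0 \/ j = 1.
Proof. by case: j => -[|[|//]] j2; [left|right]; exact/val_inj. Qed.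

Lemma within_continuous_coord a b c j : {within `[a, b], continuous c} ->
  {within `[a, b], continuous (fun t => c t 0 j)}.
Proof.
move=> cc t; apply: (@cvg_comp _ _ _ c (fun M : 'rV[R]_2 => M 0 j) _ _ _ (cc t)).
exact: coord_continuous.
Qed.

Lemma row2P (u v : 'rV[R]_2) : u 0 0 = v 0 0 -> u 0 1 = v 0 1 -> u = v.
Proof.
by move=> e0 e1; apply/rowP => j; have [->|->] := ord2_cases j.
Qed.

Lemma row2_neq0 (u : 'rV[R]_2) : u != 0 -> 0 < u 0 0 ^+ 2 + u 0 1 ^+ 2.
Proof.
move=> u0; rewrite lt_neqAle addr_ge0 ?sqr_ge0// andbT eq_sym.
apply: contra u0; rewrite paddr_eq0 ?sqr_ge0// !sqrf_eq0 => /andP[/eqP e0 /eqP e1].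
by apply/eqP/row2P; rewrite ?e0 ?e1 mxE.
Qed.

(* [Q] is the speed of [c], and [phi] is the angle of its tangent; the curvature
   of [c] is [kappa / Q]. *)
Record tangent_angle a b c phi kappa : Prop := TangentAngle {
  tangent_angle_primitive : primitive a b phi kappa ;
  tangent_angle_speed : exists Q, [/\ forall t, a <= t -> t <= b -> 0 < Q t,
    forall t, a < t -> t < b -> is_derive t 1 c (Q t *: expi (phi t)),
    rderiv c a = Q a *: expi (phi a) &
    lderiv c b = Q b *: expi (phi b)] }.

(** The continuous representative [v] of the weak derivative is the classical derivative inside and
    the one-sided derivative at each end. Regularity thus makes [v] nonzero on the closed interval,
    as [polar_lift] requires. *)
Lemma regular_arc_angle a b c : a < b -> {within `[a, b], continuous c} ->
  W21 a b c -> regular a b c -> exists phi kappa, tangent_angle a b c phi kappa.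
Proof.
move=> ab cc cW [reg rega regb].
have cj j := within_continuous_coord a b c j cc.
have prim j : exists G h, primitive a b (fun t => c t 0 j) G /\ primitive a b G h.
  have [u1 [g [ug [g1 [h [gh [h1 _]]]]]]] := cW j.
  have [G [PG Ph]] := sobolev_primitive _ _ _ _ _ ab (cj j) u1 ug g1 gh h1.
  by exists G, (h \_ `]a, b[).
have [G0 [h0 [cG0 Gh0]]] := prim 0; have [G1 [h1 [cG1 Gh1]]] := prim 1.
pose v t : 'rV[R]_2 := \row_j (if j == 0 then G0 t else G1 t).
have v0 t : v t 0 0 = G0 t by rewrite mxE.
have v1 t : v t 0 1 = G1 t by rewrite mxE.
have v0E : (fun t => v t 0 0) = G0 by exact/funext.
have v1E : (fun t => v t 0 1) = G1 by exact/funext.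
have cv j : primitive a b (fun t => c t 0 j) (fun t => v t 0 j).
  have [->|->] := ord2_cases j.
  - by rewrite v0E.
  - by rewrite v1E.
have vc j : {within `[a, b], continuous (fun t => v t 0 j)}.
  have [->|->] := ord2_cases j.
  - by rewrite v0E; exact: primitive_continuous (ltW ab) Gh0.
  - by rewrite v1E; exact: primitive_continuous (ltW ab) Gh1.
have vn0 t : a <= t -> t <= b -> v t != 0.
  rewrite !le_eqVlt => /predU1P[<-|at_] /predU1P[tb|tb].
  - by move: ab; rewrite tb ltxx.
  - by rewrite -(primitive_rderiv _ _ _ _ _ cv vc (lexx a) ab).
  - by rewrite tb -(primitive_lderiv _ _ _ _ _ cv vc ab (lexx b)).
  - have := primitive_is_derive _ _ _ _ _ cv vc at_ tb => /@derive_val <-.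
    by rewrite -derive1E; apply: reg; rewrite at_ tb.
have [|phi [kappa [Q [Pphi HQ]]]] := polar_lift _ _ _ _ _ _ (ltW ab) Gh0 Gh1.
  by move=> t at_ tb; rewrite -v0 -v1; apply/row2_neq0/vn0.
have vE t : a <= t -> t <= b -> v t = Q t *: expi (phi t).
  move=> at_ tb; have [_ e0 e1] := HQ t at_ tb.
  by apply: row2P; rewrite ?v0 ?v1 mxE ?expi0 ?expi1.
exists phi, kappa; split => //; exists Q; split.
- by move=> t at_ tb; have [] := HQ t at_ tb.
- move=> t at_ tb; rewrite -vE ?ltW//.
  exact: (primitive_is_derive _ _ _ _ _ cv vc at_ tb).
- by rewrite (primitive_rderiv _ _ _ _ _ cv vc (lexx a) ab) vE// ltW.
- by rewrite (primitive_lderiv _ _ _ _ _ cv vc ab (lexx b)) vE// ltW.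
Qed.

End regular_arcs.

(** * Curvature as the derivative of the tangent angle, and monotonicity in a direction *)

Section arc_properties.
Context {R : realType}.
Notation mu := (@lebesgue_measure R).
Implicit Types (a b s t r : R) (phi kappa F f : R -> R) (c : R -> 'rV[R]_2).

Lemma primitive_ae_is_derive a b F f : primitive a b F f ->
  {ae mu, forall t, a < t -> t < b -> is_derive t 1 F (f t)}.
Proof.
(* Extension by zero gives a density that is integrable on the whole line, as used for [FTC1]. *)
move=> Ff; pose f0 := f \_ `[a, b].
have f0i : mu.-integrable setT (EFin \o f0).
  by rewrite -restrict_EFin; apply/(integrable_mkcond _ _).1 => //; exact: Ff.1.
have L : locally_integrable setT f0.
  by apply: open_integrable_locally => //; exact: openT.
have f0y (y : R) : mu.-integrable [set` Interval (BLeft a) (BRight y)] (EFin \o f0).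
  exact: integrableT_itv.
have := FTC1 f0y L.
apply: filterS; first exact: (ae_filter_ringOfSetsType mu).
move=> t /= Ht at_ tb.
have [|] := Ht; first by rewrite lte_fin.
set G := (fun x => _) => dG GE.
have f0t : f0 t = f t by rewrite /f0 patchE mem_setE in_itv/= !ltW.
apply: (@near_eq_is_derive _ _ _ (fun x => F a + G x)).
  near=> x.
  have : x \in `]a, b[.
    by near: x; apply: near_in_itvoo; rewrite in_itv/= at_ tb.
  rewrite in_itv/= => /andP[/ltW ax /ltW xb].
  rewrite (primitiveE _ _ _ _ _ Ff ax xb); congr (_ + _).
  apply: eq_Rintegral => y; rewrite inE/= in_itv/= => /andP[ay yx].
  by rewrite /f0 patchE mem_setE in_itv/= ay (le_trans yx).
have dG' : is_derive t 1 G (f t).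
  by apply: DeriveDef => //; rewrite -derive1E GE.
have dc : is_derive t 1 (fun=> F a) (0 : R) by exact: is_derive_cst.
rewrite -[f t]add0r; exact: is_deriveD.
Unshelve. all: by end_near. Qed.

Lemma is_derive_expi phi t (l : R) : is_derive t 1 phi l ->
  is_derive t 1 (fun x => expi (phi x)) (l *: rot90 (expi (phi t))).
Proof.
move=> dphi.
have dc : is_derive t 1 (fun x => cos (phi x)) (- sin (phi t) * l).
  by apply: (@is_derive1_comp _ (@cos R) phi); exact: is_derive_cos.
have ds : is_derive t 1 (fun x => sin (phi x)) (cos (phi t) * l).
  by apply: (@is_derive1_comp _ (@sin R) phi); exact: is_derive_sin.
have c0 : (fun x => expi (phi x) 0 0) = (fun x => cos (phi x)).
  by apply/funext => x; rewrite expi0.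
have c1 : (fun x => expi (phi x) 0 1) = (fun x => sin (phi x)).
  by apply/funext => x; rewrite expi1.
have der : derivable (fun x => expi (phi x)) t 1.
  apply/derivable_mxP => i j; rewrite ord1.
  have [->|->] := ord2_cases j.
  - by rewrite c0; exact: ex_derive.
  - by rewrite c1; exact: ex_derive.
apply: DeriveDef => //; rewrite derive_mx//; apply: row2P; rewrite !mxE/=.
- by rewrite c0 derive_val mulrC.
- by rewrite c1 derive_val mulrC.
Qed.

(** The unit tangent is [expi (phi t)], whose derivative is [kappa t] times the normal wherever
    [phi] has derivative [kappa t]. This exceptional set does not depend on [k], which may therefore
    be quantified after [t]. *)
Lemma tangent_angle_curvature a b c phi kappa : tangent_angle a b c phi kappa ->
  {ae mu, forall t, a < t -> t < b -> forall k : R,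
    arc_deriv c (arc_deriv c c) t = k *: normal c t ->
    kappa t = k * enorm (c^`()%classic t)}.
Proof.
case=> Pphi [Q [Q0 dc _ _]]; have := primitive_ae_is_derive _ _ _ _ Pphi.
apply: filterS; first exact: (ae_filter_ringOfSetsType mu).
move=> t Ht at_ tb k; have dphi := Ht at_ tb.
have cE s : a < s -> s < b -> c^`()%classic s = Q s *: expi (phi s).
  by move=> as_ sb; rewrite derive1E; have /@derive_val := dc s as_ sb.
have Qs s : a < s -> s < b -> 0 < Q s.
  by move=> as_ sb; apply: Q0; exact: ltW.
have tE s : a < s -> s < b -> arc_deriv c c s = expi (phi s).
  move=> as_ sb; rewrite /arc_deriv cE// enorm_expi ?Qs//.
  by rewrite scalerA mulVf ?scale1r// gt_eqF// Qs.
have dT : (arc_deriv c c)^`()%classic t = kappa t *: rot90 (expi (phi t)).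
  have dT : is_derive t 1 (arc_deriv c c) (kappa t *: rot90 (expi (phi t))).
    apply: (@near_eq_is_derive _ _ _ (fun x => expi (phi x))).
      near=> x; have : x \in `]a, b[.
        by near: x; apply: near_in_itvoo; rewrite in_itv/= at_ tb.
      by rewrite in_itv/= => /andP[ax xb]; rewrite tE.
    exact: is_derive_expi.
  by rewrite derive1E; have /@derive_val := dT.
rewrite {1}/arc_deriv dT /normal /tangent tE// cE// enorm_expi ?Qs// scalerA.
move=> E.
have w0 : dot (rot90 (expi (phi t))) (rot90 (expi (phi t))) = 1.
  rewrite dotE !mxE/=; have := cos2Dsin2 (phi t); lra.
(* Pairing with the unit normal turns the vector equation into a scalar one. *)
have := congr1 (fun w => dot w (rot90 (expi (phi t)))) E.
rewrite !dotZl w0 !mulr1 => <-; rewrite mulrAC mulVf ?mul1r// gt_eqF//.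
exact: Qs.
Unshelve. all: by end_near. Qed.

(** The component of [c] along [expi u] has derivative [Q t * cos (phi t - u)], which is positive;
    the mean value theorem concludes. *)
Lemma tangent_angle_dot_lt a b c phi kappa (u : R) : a < b ->
  {within `[a, b], continuous c} -> tangent_angle a b c phi kappa ->
  (forall t, a <= t -> t <= b -> 0 < cos (phi t - u)) ->
  dot (c a) (expi u) < dot (c b) (expi u).
Proof.
move=> ab cc [Pphi [Q [Q0 dc _ _]]] pos.
pose F t := dot (c t) (expi u).
have cj j := within_continuous_coord a b c j cc.
have FE : F = (fun t => c t 0 0 * cos u + c t 0 1 * sin u).
  by apply/funext => t; rewrite /F dotE expi0 expi1.
have cF : {within `[a, b], continuous F}.
  rewrite FE => t; apply: cvgD; (apply: cvgM; last exact: cvg_cst).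
    exact: cj.
  exact: cj.
have dF t : t \in `]a, b[ -> is_derive t 1 F (Q t * cos (phi t - u)).
  rewrite in_itv/= => /andP[at_ tb]; have dct := dc t at_ tb.
  have dcj j : is_derive t 1 (fun t => c t 0 j) ((Q t *: expi (phi t)) 0 j).
    have der : derivable c t 1 by exact: ex_derive.
    apply: DeriveDef; first exact: (derivable_mxP _ _ _).1 der 0 j.
    by have := derive_mx der; have /@derive_val -> := dct => ->; rewrite !mxE.
  have dZ j (k : R) : is_derive t 1 (fun t => c t 0 j * k)
      ((Q t *: expi (phi t)) 0 j * k).
    have -> : (fun t => c t 0 j * k) = k \*: (fun t => c t 0 j).
      by apply/funext => x; exact: mulrC.
    by rewrite mulrC; have d := dcj j; exact: is_deriveZ.
  rewrite FE.
  have -> : Q t * cos (phi t - u) = (Q t *: expi (phi t)) 0 0 * cos u +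
      (Q t *: expi (phi t)) 0 1 * sin u.
    by rewrite cosB !mxE/=; ring.
  have d0 := dZ 0 (cos u); have d1 := dZ 1 (sin u).
  exact: is_deriveD.
rewrite -subr_gt0 -[X in 0 < X]/(F b - F a); have [z + ->] := MVT ab dF cF.
rewrite in_itv/= => /andP[az zb].
by rewrite mulr_gt0 ?subr_gt0// mulr_gt0//; [apply: Q0|apply: pos]; exact: ltW.
Qed.

End arc_properties.

(** * Closed curves *)

Section turning.
Context {R : realType}.
Notation mu := (@lebesgue_measure R).
Implicit Types (a b s t r u : R).

(** Equality of [expi] values plays the role of congruence modulo [2 pi]. *)
Lemma expi_addr (u v w : R) : expi u = expi v -> expi (u + w) = expi (v + w).
Proof.
move=> uv; have := congr1 (fun M : 'rV[R]_2 => M 0 0) uv.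
have := congr1 (fun M : 'rV[R]_2 => M 0 1) uv.
rewrite !expi0 !expi1 => suv cuv.
by apply: row2P; rewrite ?expi0 ?expi1 ?cosD ?sinD suv cuv.
Qed.

(** Equal cosines force the sines to agree up to sign, so [j] is [theta] or [- theta]: a left or a
    right turn. *)
Lemma cos_eq_expi (u v theta : R) : cos theta = cos (v - u) ->
  exists j, `|j| = `|theta| /\ expi v = expi (u + j).
Proof.
have [d ->] : exists d, v = u + d by exists (v - u); rewrite addrC subrK.
rewrite addrAC subrr add0r => cE.
have /eqP : sin theta ^+ 2 = sin d ^+ 2 by rewrite !sin2cos2 cE.
rewrite eqf_sqr => /orP[] /eqP sE.
  exists theta; split => //.
  by apply: row2P; rewrite ?expi0 ?expi1 ?cosD ?sinD sE cE.
exists (- theta); split; first exact: normrN.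
by apply: row2P; rewrite ?expi0 ?expi1 ?cosD ?sinD !cosN !sinN sE cE opprK.
Qed.

Lemma cos_eq1_lt2pi u : cos u = 1 -> `|u| < 2 * pi -> u = 0.
Proof.
move=> cu u2; apply/eqP/negPn/negP => un0.
have n0 : 0 < `|u| by rewrite normr_gt0.
have [w uE] : exists w, `|u| = w *+ 2.
  by exists (`|u| / 2); rewrite -[RHS]mulr_natr divfK.
(* Half of [|u|] lies where the sine is positive, while [cos (w *+ 2) = 1] forces [sin w] to
   vanish. *)
have w0 : 0 < w < pi by rewrite uE -mulr_natl in n0 u2; apply/andP; split; lra.
have := sin_gt0_pi w0; have : cos (w *+ 2) = 1 by rewrite -uE cos_norm.
rewrite cos_mulr2n => cE.
have /eqP : sin w ^+ 2 = 0 by rewrite sin2cos2; lra.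
by rewrite sqrf_eq0 => /eqP ->; rewrite ltxx.
Qed.

Lemma spread_center (E : set R) (D : R) : E !=set0 ->
  (forall y z, E y -> E z -> `|y - z| <= D) ->
  exists u, forall y, E y -> `|y - u| <= D / 2.
Proof.
move=> [y0 Ey0] ED.
have ubE z : E z -> ubound E (z + D).
  by move=> Ez y Ey; have := ler_norm (y - z); have := ED y z Ey Ez; lra.
have hS : has_sup E by split; [exists y0 | exists (y0 + D); exact: ubE].
have leS y : E y -> y <= sup E by apply: ub_le_sup; exact: hS.2.
have geS y : E y -> sup E <= y + D.
  by move=> Ey; apply: ge_sup; [exists y0 | exact: ubE].
(* The midpoint of the interval from [sup E - D] to [sup E], which contains [E]. *)
exists (sup E - D / 2) => y Ey; rewrite ler_norml.
by have := leS y Ey; have := geS y Ey; move: (sup E) => m *; apply/andP; split; lra.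
Qed.

(** The integral of a nonnegative function is a supremum over the simple functions below it, and a
    larger function admits more of them. *)
Lemma ge0_le_integral_nonmeasurable d (T : measurableType d)
    (m : {measure set T -> \bar R}) (D : set T) (f g : T -> \bar R) :
  (forall x, D x -> 0 <= f x)%E -> (forall x, D x -> f x <= g x)%E ->
  (\int[m]_(x in D) f x <= \int[m]_(x in D) g x)%E.
Proof.
move=> f0 fg; have g0 x : D x -> (0 <= g x)%E.
  by move=> Dx; exact: le_trans (f0 x Dx) (fg x Dx).
rewrite !ge0_integralE//; apply: le_ereal_sup => _ [h hf <-]; exists h => // x.
apply: (le_trans (hf x)); rewrite !patchE; case: ifPn => // xD.
by apply: fg; move: xD; rewrite inE.
Qed.

(* In the proof, [sigma i] is the angle reached at the beginning of the i-th arc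
   after turning continuously along the previous arcs and by [J m] at the m-th
   vertex, and [A i] bounds the corresponding total variation. *)
Lemma total_turning_ge (gamma : R -> 'rV[R]_2) (N : nat) (x : nat -> R)
    (theta J : nat -> R) (phi kappa : nat -> R -> R) :
  (0 < N)%N ->
  (forall i, (i < N)%N -> x i < x i.+1) ->
  (forall i, (i < N)%N -> {within `[x i, x i.+1], continuous gamma}) ->
  gamma (x 0%N) = gamma (x N) ->
  (forall i, (i < N)%N ->
    tangent_angle (x i) (x i.+1) gamma (phi i) (kappa i)) ->
  (forall i, (1 <= i <= N)%N -> `|J i| <= theta i /\
    expi (phi (i %% N)%N (x (i %% N)%N)) = expi (phi i.-1 (x i) + J i)) ->
  2 * pi <= \sum_(i < N)
    (\int[mu]_(t in `[x i, x i.+1]) `|kappa i t| + theta i.+1).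
Proof.
move=> N0 xi gc gN ta vert; rewrite leNgt; apply/negP => L2.
pose l i t := \int[mu]_(s in `[x i, t]) `|kappa i s|.
pose sigma n := phi 0%N (x 0%N) +
  \sum_(i < n) (phi i (x i.+1) - phi i (x i) + J i.+1).
pose A n := \sum_(i < n) (l i (x i.+1) + theta i.+1).
(* The angle of the i-th arc, shifted by a constant so as to start at [sigma i]; by [esigma] the
   shift leaves the direction unchanged. *)
pose f i t := sigma i + (phi i t - phi i (x i)).
have sigmaS n : sigma n.+1 = sigma n + (phi n (x n.+1) - phi n (x n) + J n.+1).
  by rewrite /sigma big_ord_recr/= addrA.
have AS n : A n.+1 = A n + (l n (x n.+1) + theta n.+1).
  by rewrite /A big_ord_recr.
have sigma0 : sigma 0%N = phi 0%N (x 0%N) by rewrite /sigma big_ord0 addr0.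
have A0 : A 0%N = 0 by rewrite /A big_ord0.
have esigma n : (n <= N)%N -> expi (sigma n) = expi (phi (n %% N)%N (x (n %% N)%N)).
  elim: n => [_|n ih nN]; first by rewrite sigma0 mod0n.
  (* For [n.+1 = N] the index wraps round to the initial arc: the direction closes up after one
     period. *)
  have [_ ->] := vert n.+1 nN.
  have := ih (ltnW nN); rewrite modn_small// => e.
  rewrite sigmaS (expi_addr _ _ _ e)/=; congr expi.
  by move: (phi n _) (phi n _) => *; ring.
have ef i t : (i < N)%N -> expi (f i t) = expi (phi i t).
  move=> iN; rewrite /f; have := esigma i (ltnW iN); rewrite modn_small// => e.
  by rewrite (expi_addr _ _ _ e); congr expi; rewrite addrC subrK.
have lvar i s t : (i < N)%N -> x i <= s -> s <= t -> t <= x i.+1 ->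
    `|phi i t - phi i s| <= l i t - l i s.
  move=> iN xs st tx; have [[ki Pphi] _] := ta i iN.
  have nki := integrable_norm ki.
  have lE : l i t - l i s = \int[mu]_(r in `[s, t]) `|kappa i r|.
    exact: (integral_primitive _ _ _ nki).2.
  rewrite Pphi// lE; apply: le_normr_Rintegral => //.
  exact: integrable_subitv ki xs tx.
have lx i : l i (x i) = 0 by rewrite /l set_itv1 Rintegral_set1.
have xile i : (i < N)%N -> x i <= x i.+1 by move=> /xi/ltW.
have fstart i t : (i < N)%N -> x i <= t -> t <= x i.+1 ->
    `|f i t - sigma i| <= l i t.
  move=> iN xt tx; rewrite /f addrAC subrr add0r.
  by have := lvar i (x i) t iN (lexx _) xt tx; rewrite lx subr0.
have fend i t : (i < N)%N -> x i <= t -> t <= x i.+1 ->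
    `|sigma i.+1 - f i t| <= A i.+1 - (A i + l i t).
  move=> iN xt tx; have -> : sigma i.+1 - f i t =
      (phi i (x i.+1) - phi i t) + J i.+1.
    by rewrite sigmaS /f; move: (sigma i) (phi i t) (phi i _) (phi i _) => *; ring.
  have -> : A i.+1 - (A i + l i t) = (l i (x i.+1) - l i t) + theta i.+1.
    by rewrite AS; move: (A i) (l i t) (l i _) => *; ring.
  apply: (le_trans (ler_normD _ _)); apply: lerD; first exact: lvar.
  by have [] := vert i.+1 iN.
have svar i n : (i + n <= N)%N -> `|sigma (i + n)%N - sigma i| <= A (i + n)%N - A i.
  elim: n => [_|n ih]; first by rewrite addn0 !subrr normr0.
  rewrite addnS => inN; have {}ih := ih (ltnW inN).
  have h1 := fend (i + n)%N (x (i + n)%N) inN (lexx _) (xile _ inN).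
  have h2 := fstart (i + n)%N (x (i + n)%N) inN (lexx _) (xile _ inN).
  rewrite lx in h1 h2; move: h1 h2 ih.
  move: (sigma _) (sigma _) (sigma _) (f _ _) (A _) (A _) (A _).
  move=> s1 s2 s3 y a1 a2 a3; rewrite !ler_norml.
  by move=> /andP[? ?] /andP[? ?] /andP[? ?]; apply/andP; split; lra.
have svarle i j : (i <= j)%N -> (j <= N)%N -> `|sigma j - sigma i| <= A j - A i.
  by move=> ij jN; have := svar i (j - i)%N; rewrite subnKC//; exact.
(* Both angles give the same direction and differ by at most [A N < 2 * pi], so they coincide. *)
have sigmaN : sigma N = sigma 0%N.
  apply/eqP; rewrite -subr_eq0; apply/eqP/cos_eq1_lt2pi.
    have e : expi (sigma N) = expi (sigma 0%N) by rewrite esigma// modnn sigma0.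
    by rewrite -dot_expi e dot_expi subrr cos0.
  apply: (le_lt_trans (svarle 0%N N (leq0n _) (leqnn _))).
  by rewrite A0 subr0.
have fclose i t j s : (i < N)%N -> x i <= t -> t <= x i.+1 ->
    (j < N)%N -> x j <= s -> s <= x j.+1 -> (i < j)%N || (i == j) && (t <= s) ->
    `|f j s - f i t| <= A N / 2.
  move=> iN xt tx jN xs sx ijts.
  (* The variation along the curve from [t] forward to [s]. *)
  have h : `|f j s - f i t| <= (A j + l j s) - (A i + l i t).
    case/orP: ijts => [ij|/andP[/eqP ij ts]].
      have h1 := fstart j s jN xs sx; have h2 := fend i t iN xt tx.
      have h3 := svarle i.+1 j ij (ltnW jN); move: h1 h2 h3.
      move: (sigma _) (sigma _) (f _ _) (f _ _) (A _) (A _) (A _) (l _ _) (l _ _).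
      move=> s1 s2 y1 y2 a1 a2 a3 l1 l2; rewrite !ler_norml.
      by move=> /andP[? ?] /andP[? ?] /andP[? ?]; apply/andP; split; lra.
    rewrite -{j jN xs}ij in sx *.
    have := lvar i t s iN xt ts sx; rewrite /f.
    move: (sigma i) (phi i s) (phi i t) (phi i (x i)) (A i) (l i s) (l i t).
    move=> s1 p1 p2 p3 a1 l1 l2; rewrite !ler_norml => /andP[? ?].
    by apply/andP; split; lra.
  (* The complementary way: from [s] to the end of the period and from its beginning to [t], joined
     by [sigmaN]. Its bound and that of [h] sum to [A N]. *)
  have h1 := fstart i t iN xt tx; have h2 := svarle 0%N i (leq0n _) (ltnW iN).
  have h3 := fend j s jN xs sx; have h4 := svarle j.+1 N jN (leqnn _).
  rewrite A0 sigmaN in h2 h4; move: h h1 h2 h3 h4.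
  move: (sigma _) (sigma _) (sigma _) (f _ _) (f _ _) (A _) (A _) (A _) (A _) (l _ _) (l _ _).
  move=> s1 s2 s3 y1 y2 a1 a2 a3 a4 l1 l2; rewrite !ler_norml.
  move=> /andP[? ?] /andP[? ?] /andP[? ?] /andP[? ?] /andP[? ?].
  by apply/andP; split; lra.
pose E := [set y | exists i t, [/\ (i < N)%N, x i <= t, t <= x i.+1 & y = f i t]].
have [|y z [i [t [iN xt tx ->]]] [j [s [jN xs sx ->]]]|u Eu] := spread_center E (A N / 2).
- by exists (f 0%N (x 0%N)), 0%N, (x 0%N); split=> //; exact: xile.
- have [ij|ji|ij] := ltngtP i j.
  + by rewrite distrC; apply: fclose => //; rewrite ij.
  + by apply: fclose => //; rewrite ji.
  + have [ts|/ltW st] := leP t s.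
      by rewrite distrC; apply: fclose => //; rewrite ij ltnn eqxx.
    by apply: fclose => //; rewrite ij ltnn eqxx.
have incr i : (i < N)%N ->
    dot (gamma (x i)) (expi u) < dot (gamma (x i.+1)) (expi u).
  move=> iN; apply: (tangent_angle_dot_lt _ _ _ _ _ _ (xi i iN) (gc i iN) (ta i iN)).
  move=> t xt tx; rewrite -dot_expi -ef// dot_expi.
  have : `|f i t - u| <= A N / 2 / 2 by apply: Eu; exists i, t.
  have {}L2 : A N < 2 * pi by [].
  rewrite ler_norml => /andP[h1 h2]; apply: cos_gt0_pihalf; apply/andP; split; lra.
have mono n : (n < N)%N -> dot (gamma (x 0%N)) (expi u) < dot (gamma (x n.+1)) (expi u).
  elim: n => [|n ih] nN; first exact: incr.
  exact: lt_trans (ih (ltnW nN)) (incr _ nN).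
by have := mono N.-1; rewrite prednK// leqnn gN ltxx => /(_ isT).
Qed.

End turning.

(** * From the arcs to the integral of the curvature over the whole curve *)

Section curvature_integral.
Context {R : realType}.
Notation mu := (@lebesgue_measure R).

Lemma knots_le (N : nat) (x : nat -> R) (i j : nat) :
  (forall i, (i < N)%N -> x i < x i.+1) -> (i <= j)%N -> (j <= N)%N ->
  x i <= x j.
Proof.
move=> xi; elim: j => [|j ih]; first by rewrite leqn0 => /eqP ->.
rewrite leq_eqVlt => /predU1P[->//|ij] jN.
exact: le_trans (ih ij (ltnW jN)) (ltW (xi j jN)).
Qed.

(* The curvature is only determined almost everywhere, so the integrand [w] may
   fail to be measurable. *)
Lemma sum_integral_arcs_le (N : nat) (x : nat -> R) (kappa : nat -> R -> R)
    (w : R -> R) :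
  (forall i, (i < N)%N -> x i < x i.+1) ->
  (forall i, (i < N)%N -> mu.-integrable `[x i, x i.+1] (EFin \o kappa i)) ->
  (forall t, 0 <= w t) ->
  {ae mu, forall t i, (i < N)%N -> x i < t -> t < x i.+1 -> `|kappa i t| <= w t} ->
  ((\sum_(i < N) \int[mu]_(t in `[x i, x i.+1]) `|kappa i t|)%:E <=
   \int[mu]_(t in `[x 0%N, x N]) (w t)%:E)%E.
Proof.
move=> xi ki w0 [Z [mZ Z0 HZ]].
pose D := `[x 0%N, x N]%classic.
have mD : measurable D by exact: measurable_itv.
(* Open arcs are disjoint, so at each [t] at most one term of the sum is nonzero; the knots have
   measure zero. *)
pose g (i : 'I_N) : R -> R :=
  (fun t => `|kappa i t|) \_ `]x i, x i.+1[%classic.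
have g0 i t : 0 <= g i t by rewrite /g patchE; case: ifP.
have noi (i : 'I_N) : mu.-integrable `]x i, x i.+1[ (EFin \o (fun t => `|kappa i t|)).
  apply: integrable_norm; apply: integrableS (ki i (ltn_ord i)) => //.
  exact: subset_itv_oo_cc.
have gi i : mu.-integrable setT (EFin \o g i).
  by rewrite -restrict_EFin; apply/(integrable_mkcond _ _).1.
have subD (i : 'I_N) : `]x i, x i.+1[%classic `<=` D.
  move=> t /=; rewrite !in_itv/= => /andP[/ltW xt /ltW tx]; apply/andP; split.
    exact: le_trans (knots_le _ _ _ _ xi (leq0n i) (ltnW (ltn_ord i))) xt.
  exact: le_trans tx (knots_le _ _ _ _ xi (ltn_ord i) (leqnn N)).
have gE (i : 'I_N) : (\int[mu]_(t in `[x i, x i.+1]) `|kappa i t|)%:E =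
    (\int[mu]_(t in D) (g i t)%:E)%E.
  rewrite -Rintegral_itv_obnd_cbnd; last first.
    apply: integrable_norm; apply: integrableS (ki i (ltn_ord i)) => //.
    exact: subset_itv_oc_cc.
  rewrite -Rintegral_itv_bndo_bndc// /Rintegral fineK; last first.
    exact: integrable_fin_num.
  have {1}-> : `]x i, x i.+1[%classic = D `&` `]x i, x i.+1[%classic.
    by rewrite setIidr//; exact: subD.
  rewrite integral_mkcondr; apply: eq_integral => t _.
  by rewrite /g restrict_EFin.
pose F t := \sum_(i < N) g i t.
have F0 t : 0 <= F t by apply: sumr_ge0.
have mg i : measurable_fun D (EFin \o g i).
  have /integrableP[mg _] := gi i; exact: measurable_funS mg.
have -> : (\sum_(i < N) \int[mu]_(t in `[x i, x i.+1]) `|kappa i t|)%:E =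
    (\int[mu]_(t in D) (F t)%:E)%E.
  rewrite -sumEFin; under eq_bigr do rewrite gE.
  rewrite -ge0_integral_sum//.
    by apply: eq_integral => t _; rewrite -sumEFin.
  by move=> i t _; rewrite lee_fin.
have mF : measurable_fun D (fun t => (F t)%:E).
  have -> : (fun t => (F t)%:E) = (fun t => \sum_(i < N) (g i t)%:E)%E.
    by apply/funext => t; rewrite -sumEFin.
  by apply: emeasurable_sum => i; exact: mg.
(* The exceptional set is removed from the integral of the measurable [F]; the comparison with [w]
   then holds at every point and requires only monotonicity. *)
rewrite (ge0_negligible_integral mZ mD mF _ Z0); last first.
  by move=> t _; rewrite lee_fin.
rewrite setDE integral_mkcondr; apply: ge0_le_integral_nonmeasurable => t Dt.
  by rewrite patchE; case: ifP => // _; rewrite lee_fin.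
rewrite patchE; case: ifPn => [|_]; last by rewrite lee_fin.
rewrite inE/= => nZ; rewrite lee_fin.
have Pt i : (i < N)%N -> x i < t -> t < x i.+1 -> `|kappa i t| <= w t.
  by apply: contrapT => nP; apply: nZ; apply: HZ => /= H; apply: nP; exact: H.
have [[i iN]|no] := pselect (exists i : 'I_N, `]x i, x i.+1[%classic t).
  rewrite /F (bigD1 i)//= big1 ?addr0; last first.
    move=> j ji; rewrite /g patchE; case: ifPn => //; rewrite inE => jN.
    exfalso; move: iN jN; rewrite /= !in_itv/= => /andP[xit tix] /andP[xjt tjx].
    have [ij|ij|/val_inj ij] := ltngtP i j.
    - by have := knots_le _ _ _ _ xi ij (ltnW (ltn_ord j)); lra.
    - by have := knots_le _ _ _ _ xi ij (ltnW (ltn_ord i)); lra.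
    - by move: ji; rewrite ij eqxx.
  rewrite /g patchE mem_set//.
  by move: iN; rewrite /= in_itv/= => /andP[xit tix]; exact: Pt.
rewrite /F big1// => i _; rewrite /g patchE; case: ifPn => //; rewrite inE => it.
by exfalso; apply: no; exists i.
Qed.

End curvature_integral.

Theorem theoremA1 (R : realType) (gamma : R -> 'rV[R]_2) (N : nat)
    (x : nat -> R) (theta : nat -> R) (k : R -> R)
    (gamma_cont : {within `[0, 1], continuous gamma})
    (gamma_closed : gamma 0 = gamma 1)
    (x0 : x 0%N = 0) (xN : x N = 1)
    (x_incr : forall i : nat, (i < N)%N -> x i < x i.+1)
    (gamma_W21 : forall i : nat, (i < N)%N -> W21 (x i) (x i.+1) gamma)
    (gamma_regular : forall i : nat, (i < N)%N -> regular (x i) (x i.+1) gamma)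
    (theta_angle : forall i : nat, (1 <= i <= N)%N ->
       is_vertex_angle gamma N x i (theta i))
    (k_curvature : is_curvature gamma k) :
  ((2 * pi - \sum_(1 <= i < N.+1) theta i)%:E <=
   \int[@lebesgue_measure R]_(t in `[0%R, 1%R])
     (`|k t| * enorm (gamma^`()%classic t))%:E)%E.
Proof.
have N0 : (0 < N)%N.
  by case: N xN {x_incr gamma_W21 gamma_regular theta_angle} => //;
    rewrite x0 => /esym/eqP; rewrite oner_eq0.
have x01 i : (i <= N)%N -> 0 <= x i <= 1.
  move=> iN; rewrite -x0 -xN !(knots_le N)//.
have gc i : (i < N)%N -> {within `[x i, x i.+1], continuous gamma}.
  move=> iN; apply: continuous_subspaceW gamma_cont => t /=.
  rewrite !in_itv/= => /andP[xt tx].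
  have /andP[xi0 _] := x01 i (ltnW iN); have /andP[_ xi1] := x01 i.+1 iN.
  by rewrite (le_trans xi0 xt) (le_trans tx xi1).
have /choice[pk ta] (i : nat) : exists pk : (R -> R) * (R -> R), (i < N)%N ->
    tangent_angle (x i) (x i.+1) gamma pk.1 pk.2.
  have [iN|iN] := boolP (i < N)%N; last by exists (id, id).
  have [phi [kappa T]] := regular_arc_angle _ _ _ (x_incr i iN) (gc i iN)
    (gamma_W21 i iN) (gamma_regular i iN).
  by exists (phi, kappa).
pose phi i := (pk i).1; pose kappa i := (pk i).2.
have /choice[J HJ] (i : nat) : exists j, (1 <= i <= N)%N -> `|j| <= theta i /\
    expi (phi (i %% N)%N (x (i %% N)%N)) = expi (phi i.-1 (x i) + j).
  have [/andP[i1 iN]|iN] := boolP (1 <= i <= N)%N; last by exists 0.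
  have [/andP[th0 _]] := theta_angle i (introT andP (conj i1 iN)).
  have i'N : (i.-1 < N)%N by rewrite prednK.
  (* The incoming direction belongs to the arc [i.-1] and the outgoing one to the arc [i %% N],
     which is the arc 0 when [i = N]. *)
  have [_ [Q [Q0 _ _ lE]]] := ta _ i'N.
  have mN : (i %% N < N)%N by rewrite ltn_mod.
  have [_ [Q' [Q'0 _ rE _]]] := ta _ mN.
  have xi1 := ltW (x_incr _ i'N); rewrite (prednK i1) in lE xi1.
  have q0 : 0 < Q (x i) by apply: Q0; rewrite ?prednK.
  have q'0 : 0 < Q' (x (i %% N)%N).
    by apply: Q'0 => //; exact/ltW/x_incr.
  rewrite lE rE !enorm_expi// dotZl dotZr dot_expi => cE.
  have [|j [jE eE]] := @cos_eq_expi R (phi i.-1 (x i))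
      (phi (i %% N)%N (x (i %% N)%N)) (theta i).
    rewrite cE -cosN opprB; field.
    by rewrite !gt_eqF.
  by exists j; rewrite jE ger0_norm.
have turn := total_turning_ge gamma N x theta J phi kappa N0 x_incr gc _ ta HJ.
have {}turn : 2 * pi <= \sum_(i < N)
    (\int[@lebesgue_measure R]_(t in `[x i, x i.+1]) `|kappa i t| + theta i.+1).
  by apply: turn; rewrite x0 xN.
pose w t := `|k t| * enorm (gamma^`()%classic t).
have w0 t : 0 <= w t by rewrite mulr_ge0// sqrtr_ge0.
have ki i : (i < N)%N ->
    (@lebesgue_measure R).-integrable `[x i, x i.+1] (EFin \o kappa i).
  by move=> iN; have [[]] := ta i iN.
have kw : {ae @lebesgue_measure R, forall t i, (i < N)%N -> x i < t ->
    t < x i.+1 -> `|kappa i t| <= w t}.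
  apply: ae_foralln => i.
  have FF := ae_filter_ringOfSetsType (@lebesgue_measure R).
  have [iN|iN] := boolP (i < N)%N; last first.
    by apply: aeW => t.
  move: k_curvature (tangent_angle_curvature _ _ _ _ _ (ta i iN)).
  apply: filterS2 => t kt ct _ xt tx.
  have t01 : t \in `[0, 1].
    have /andP[xi0 _] := x01 i (ltnW iN); have /andP[_ xi1] := x01 i.+1 iN.
    by rewrite in_itv/= (le_trans xi0 (ltW xt)) (le_trans (ltW tx) xi1).
  by rewrite [kappa i t](ct xt tx _ (kt t01)) normrM (ger0_norm (sqrtr_ge0 _)).
have := sum_integral_arcs_le N x kappa w x_incr ki w0 kw.
rewrite x0 xN; apply: le_trans; rewrite lee_fin lerBlDr.
apply: (le_trans turn); rewrite big_split/= lerD2l.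
by rewrite big_add1/= big_mkord.
Qed.
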